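(* For each $k\ge1$ let $d_k>0$, $C_k>0$, and let $Q_k$ be a real polynomial of exact degree $r_k\ge1$ with $$Q_k(x)=a_{0,k}+2\sum_{m=1}^{r_k}a_{m,k}T_m(x),\qquad a_{m,k}\ge0\ (0\le m\le r_k),\quad a_{r_k,k}>0,$$ such that every (complex) zero of $Q_k$ belongs to $[-1,1)$. Set $f_k(z)=C_kQ_k(\cos(d_kz))$ for $z\in\mathbb{C}$. Suppose that $f_k\to F$ locally uniformly on $\mathbb{C}$, $F(0)>0$, $d_k\to0$, and $\operatorname{ord}(F)<2$. List the positive zeros of $F$, with multiplicity (one representative from each pair $\pm\gamma_n$ of zeros), as $$0<\gamma_1\le\gamma_2\le\cdots,$$ where the list is allowed to be finite or empty. Then $$\sum_n\frac1{\gamma_n^2}<\infty,$$ and for every $A>0$ such that $F(A)F(-A)\ne0$, $$\limsup_{k\to\infty} r_kd_k^2\le 4\sum_{\gamma_n>A}\frac1{\gamma_n^2}.$$ In particular, $r_kd_k^2\to0$ as $k\to\infty$.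
   Context: $T_m$ denotes the Chebyshev polynomial of the first kind, $T_m(\cos\theta)=\cos(m\theta)$. Locally uniform convergence on $\mathbb{C}$ means uniform convergence on every compact subset of $\mathbb{C}$. For an entire function $F$, $M_F(R)=\max_{|z|=R}|F(z)|$ and the order is $\operatorname{ord}(F)=\limsup_{R\to\infty}\frac{\log\log M_F(R)}{\log R}$ (with the usual convention that constants have order $0$). *)

(* Defs.v *)
From HB Require Import structures.
From mathcomp Require Import all_boot all_order all_algebra.
From mathcomp Require Import all_classical all_reals all_analysis.
From mathcomp Require Import complex.
From mathcomp Require Import ring.

Set Implicit Arguments.
Unset Strict Implicit.
Unset Printing Implicit Defensive.

Import Order.TTheory GRing.Theory Num.Theory.
Import numFieldNormedType.Exports.

Local Open Scope classical_set_scope.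
Local Open Scope ring_scope.
Local Open Scope complex_scope.

(* R[i] seen as a numClosedFieldType, whose carrier has the topology and the
   normed-module structure that R[i] itself lacks. *)
Definition Cplx (R : realType) : numClosedFieldType := R[i].

Section ComplexFunctions.
Variable R : realType.
Implicit Types (F G : Cplx R -> Cplx R) (z a : Cplx R).

Definition cabs z : R := Normc.normc z.

Definition cexp z : Cplx R :=
  (expR (complex.Re z) * cos (complex.Im z))
    +i* (expR (complex.Re z) * sin (complex.Im z)).

Definition ci : Cplx R := 0 +i* 1.

Definition ccos z : Cplx R := (cexp (ci * z) + cexp (- (ci * z))) / 2.

Lemma ccos_real (x : R) : ccos (x%:C) = (cos x)%:C.
Proof.
rewrite /ccos; have -> : ci * x%:C = 0 +i* x :> Cplx R.
  by apply/eqP; rewrite eq_complex /= !mul0r mulr0 subr0 mul1r add0r !eqxx.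
rewrite /cexp /= oppr0 !expR0 !mul1r cosN sinN.
apply: (mulIf (_ : 2 != 0 :> Cplx R)); first by rewrite pnatr_eq0.
rewrite divfK ?pnatr_eq0 // mulr_natr mulr2n.
by apply/eqP; rewrite eq_complex /= subrr addr0 !eqxx.
Qed.

Definition maxmod F (r : R) : R := sup [set cabs (F z) | z in [set z | cabs z = r]].

(* Constants are treated apart: for a nonconstant entire F one has
   maxmod F r > 1 for large r, so that both logarithms are genuine. *)
Definition growth_order F : \bar R :=
  if `[< exists c, forall z, F z = c >] then 0%E
  else limf_esup (fun r : R => (ln (ln (maxmod F r)) / ln r)%:E) (pinfty_nbhs R).

(* F vanishes at a to order exactly m; m = 0 means F a != 0. *)
Definition vanishing_order F a (m : nat) : Prop :=
  exists G, [/\ \forall z \near a, derivable G z 1, G a != 0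
              & \forall z \near a, F z = (z - a) ^+ m * G z].

(* The family (gamma n), n in I, lists the positive zeros of F with
   multiplicity in nondecreasing order; I is an initial segment of nat,
   finite or not, and gamma n is the (n+1)-st zero. *)
Definition lists_positive_zeros F (I : set nat) (gamma : nat -> R) : Prop :=
  [/\ forall m n, (m <= n)%N -> I n -> I m,
      forall n, I n -> 0 < gamma n,
      forall m n, I n -> (m <= n)%N -> gamma m <= gamma n
    & forall x : R, 0 < x -> exists2 m : nat,
        ([set n | I n /\ gamma n = x] #= `I_m)%card & vanishing_order F (x%:C) m].

End ComplexFunctions.

Section Chebyshev.
Variable R : realType.

Fixpoint chebT_pair (m : nat) : {poly R} * {poly R} :=
  if m is m'.+1 then let: (p, q) := chebT_pair m' in (q, 2 *: 'X * q - p)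
  else (1, 'X).

Definition chebT (m : nat) : {poly R} := (chebT_pair m).1.

Lemma chebT0 : chebT 0 = 1. Proof. by []. Qed.

Lemma chebT1 : chebT 1 = 'X. Proof. by []. Qed.

Lemma chebTS m : chebT m.+2 = 2 *: 'X * chebT m.+1 - chebT m.
Proof. by rewrite /chebT /=; case: (chebT_pair m). Qed.

Lemma chebT_cos m (t : R) : (chebT m).[cos t] = cos (m%:R * t).
Proof.
suff: (chebT m).[cos t] = cos (m%:R * t) /\
      (chebT m.+1).[cos t] = cos (m.+1%:R * t) by case.
elim: m => [|m [IH0 IH1]].
  by rewrite chebT0 chebT1 !hornerE cos0; split.
split=> //; rewrite chebTS !hornerE IH0 IH1.
have -> : m.+2%:R * t = m.+1%:R * t + t by rewrite -addn1 natrD mulrDl mul1r.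
have -> : m%:R * t = m.+1%:R * t - t by rewrite -addn1 natrD mulrDl mul1r addrK.
rewrite cosB cosD; ring.
Qed.

End Chebyshev.

(* Main.v *)
(** If x_1, ..., x_r are the zeros of Q_k, then, with m_j = d_k^2 / (2 (1 - x_j)),
      f_k(z) = f_k(0) prod_j (1 - w_k(z) m_j),
      w_k(z) = 2 (1 - cos(d_k z)) / d_k^2 -> z^2,
    and m_j >= d_k^2 / 4 because x_j >= -1.  Evaluating at z = i shows that the
    total masses sum_j m_j stay bounded.  Sort the m_j decreasingly and take
    limits along an ultrafilter U on the indices k: the j-th mass tends to mu_j,
    the total mass to some S >= sum_j mu_j, and the products to an entire
    function of z^2, which is F / F(0).  If lambda = S - sum_j mu_j were
    positive, F(iy) would grow at least like exp(lambda y^2 / 2), against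
    ord F < 2; hence S = sum_j mu_j.  The numbers 1 / sqrt(mu_j), for mu_j > 0,
    list the positive zeros of F.  Finally
      r_k d_k^2 / 4 <= N d_k^2 / 4 + sum_{j >= N} m_j,
    whose limit along U is the tail sum_{j >= N} mu_j, that is, the sum of
    1 / gamma_n^2 over the zeros beyond the N-th; as U is arbitrary, this
    bounds the limsup. *)
Require Import Defs.
From HB Require Import structures.
From mathcomp Require Import all_boot all_order all_algebra.
From mathcomp Require Import all_classical all_reals all_analysis.
From mathcomp Require Import complex.
From mathcomp Require Import ring lra.

Set Implicit Arguments.
Unset Strict Implicit.
Unset Printing Implicit Defensive.

Import Order.TTheory GRing.Theory Num.Theory.
Import numFieldNormedType.Exports.

Local Open Scope classical_set_scope.
Local Open Scope ring_scope.
Local Open Scope complex_scope.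

(** * Complex modulus, and limits along ultrafilters *)

Section Cabs.
Variable R : realType.
Implicit Types (z w : Cplx R) (s : seq R) (x y : R).

Lemma normCabs z : `|z| = (cabs z)%:C.
Proof. by []. Qed.

Lemma cabs_ge0 z : 0 <= cabs z.
Proof. by case: z => x y; exact: sqrtr_ge0. Qed.

Lemma cabsM z w : cabs (z * w) = cabs z * cabs w.
Proof. exact: Normc.normcM. Qed.

Lemma cabsD z w : cabs (z + w) <= cabs z + cabs w.
Proof. exact: le_normcD. Qed.

Lemma cabsN z : cabs (- z) = cabs z.
Proof. exact: normcN. Qed.

Lemma cabsBC z w : cabs (z - w) = cabs (w - z).
Proof. by rewrite -cabsN opprB. Qed.

Lemma cabs_real x : cabs x%:C = `|x|.
Proof. by rewrite /cabs /= expr0n /= addr0 sqrtr_sqr. Qed.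

Lemma cabs0 : cabs (0 : Cplx R) = 0.
Proof. exact: Normc.normc0. Qed.

Lemma cabs1 : cabs (1 : Cplx R) = 1.
Proof. exact: Normc.normc1. Qed.

Lemma cabs_eq0 z : (cabs z == 0) = (z == 0).
Proof.
by apply/eqP/eqP => [/Normc.eq0_normc//|->]; exact: cabs0.
Qed.

Lemma cabsX z n : cabs (z ^+ n) = cabs z ^+ n.
Proof. by elim: n => [|n IH]; rewrite ?cabs1 // !exprS cabsM IH. Qed.

Lemma cabs_dist z w : `|cabs z - cabs w| <= cabs (z - w).
Proof.
rewrite ler_norml; apply/andP; split.
  by rewrite lerNl opprB lerBlDr cabsBC -[X in cabs X <= _](subrK z) cabsD.
by rewrite lerBlDr -[X in cabs X <= _](subrK w) cabsD.
Qed.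

Lemma cabs_le_ReIm x y : cabs (x +i* y) <= `|x| + `|y|.
Proof.
have -> : x +i* y = x%:C + ci R * y%:C :> Cplx R.
  by apply/eqP; rewrite eq_complex /= !mul0r !mul1r ?subr0 ?addr0 ?add0r ?addr0 !eqxx.
apply: (le_trans (cabsD _ _)); rewrite cabsM !cabs_real /cabs /=.
by rewrite expr0n expr1n add0r sqrtr1 mul1r.
Qed.

Lemma Re_le_cabs z : `|complex.Re z| <= cabs z.
Proof.
case: z => x y; rewrite -sqrtr_sqr /cabs /=.
by rewrite ler_sqrt ?addr_ge0 ?sqr_ge0 // lerDl sqr_ge0.
Qed.

Lemma Im_le_cabs z : `|complex.Im z| <= cabs z.
Proof.
case: z => x y; rewrite -sqrtr_sqr /cabs /=.
by rewrite ler_sqrt ?addr_ge0 ?sqr_ge0 // lerDr sqr_ge0.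
Qed.

End Cabs.

Section Cvg.
Variables (R : realType) (T : Type) (G : set_system T).
Context {FG : Filter G}.
Implicit Types (u : T -> Cplx R) (l : Cplx R).

Lemma cvg_cabsP u l :
  u @ G --> l <-> (fun k => cabs (u k - l)) @ G --> (0 : R).
Proof.
split=> [/cvgrPdist_lt h|/cvgrPdist_lt h]; apply/cvgrPdist_lt => e e0.
  have e0' : 0 < (e%:C : Cplx R) by rewrite ltcR.
  move: (h _ e0'); apply: filterS => k.
  by rewrite normCabs ltcR sub0r normrN ger0_norm ?cabs_ge0 // cabsBC.
have eR : e = (complex.Re e)%:C by apply/esym/RRe_real/gtr0_real.
have e0' : 0 < complex.Re e by rewrite -ltcR -eR.
move: (h _ e0'); apply: filterS => k.
rewrite sub0r normrN ger0_norm ?cabs_ge0 // => hk.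
by rewrite normCabs eR ltcR cabsBC.
Qed.

Lemma cvg_cabs u l : u @ G --> l -> (fun k => cabs (u k)) @ G --> cabs l.
Proof.
move=> /cvg_cabsP /cvgrPdist_lt h; apply/cvgrPdist_lt => e /h.
apply: filterS => k; rewrite sub0r normrN ger0_norm ?cabs_ge0 //.
by apply: le_lt_trans; rewrite cabsBC; exact: cabs_dist.
Qed.

Lemma cvg_ReIm (x y : T -> R) (a b : R) :
  x @ G --> a -> y @ G --> b -> (fun k => x k +i* y k : Cplx R) @ G --> (a +i* b : Cplx R).
Proof.
move=> xa yb; apply/cvg_cabsP.
have d0 (w : T -> R) c : w @ G --> c -> (fun k => `|w k - c|) @ G --> (0 : R).
  move=> wc; rewrite -(@normr0 _ R) -(subrr c).
  by apply: cvg_norm; apply: cvgB => //; exact: cvg_cst.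
have h : (fun k => `|x k - a| + `|y k - b|) @ G --> (0 : R).
  by rewrite -[X in _ --> X](addr0 (0 : R)); apply: cvgD; exact: d0.
apply: (squeeze_cvgr _ _ h); last exact: cvg_cst.
apply: nearW => k; rewrite cabs_ge0 /=.
exact: cabs_le_ReIm.
Qed.

Lemma cvg_realC (x : T -> R) (a : R) :
  x @ G --> a -> (fun k => (x k)%:C : Cplx R) @ G --> (a%:C : Cplx R).
Proof. by move=> xa; apply: cvg_ReIm => //; exact: cvg_cst. Qed.

End Cvg.

Section Ultra.
Variables (R : realType) (T : Type) (U : set_system T).
Context {UU : UltraFilter U}.

Lemma fmap_ultra (V : Type) (g : T -> V) : UltraFilter (fmap g U).
Proof.
split=> [|H PH sH]; first exact: fmap_proper_filter.
rewrite predeqE => A; split; last exact: sH.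
move=> HA; have [//|nA] := in_ultra_setVsetC (g @^-1` A) UU.
have HnA : H (~` A) by apply: sH.
by have /filter_ex [? []] : H (A `&` ~` A) by exact: filterI.
Qed.

(** The image ultrafilter lives on the compact segment [-K, K], hence converges. This replaces every
    extraction of subsequences below. *)
Lemma ultra_bounded_cvg (x : T -> R) (K : R) :
  (forall k, `|x k| <= K) -> exists l : R, x @ U --> l.
Proof.
move=> xK.
have := @segment_compact R (- K) K; rewrite compact_ultra => /(_ (fmap x U) (fmap_ultra _)).
case=> [|l [_ xl]]; last by exists l; exact: xl.
by apply: (@filterE _ U) => k; rewrite /= in_itv /= -ler_norml.
Qed.

Lemma ultra_bounded_cvgC (z : T -> Cplx R) (K : R) :
  (forall k, cabs (z k) <= K) -> exists l : Cplx R, z @ U --> l.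
Proof.
move=> zK.
have [a ha] := @ultra_bounded_cvg (fun k => complex.Re (z k)) K
  (fun k => le_trans (Re_le_cabs _) (zK k)).
have [b hb] := @ultra_bounded_cvg (fun k => complex.Im (z k)) K
  (fun k => le_trans (Im_le_cabs _) (zK k)).
exists (a +i* b); suff -> : z = (fun k => complex.Re (z k) +i* complex.Im (z k)).
  exact: cvg_ReIm ha hb.
by apply/funext => k; case: (z k).
Qed.

End Ultra.

(** A filter is the intersection of the ultrafilters above it: if [P] is not in [G], the trace of
    [G] on the complement of [P] is proper, and an ultrafilter refining it contains that complement.
    Eventual bounds can thus be checked along each ultrafilter. *)
Lemma ultra_near (T : Type) (G : set_system T) (FG : Filter G) (P : set T) :
  (forall U : set_system T, UltraFilter U -> G `<=` U -> U P) -> G P.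
Proof.
move=> h; apply: contrapT => nGP.
have PW : ProperFilter (within (~` P) G).
  split; last exact: within_filter.
  by move=> W; apply: nGP; apply: (@filterS _ G _ _ _ _ W) => t /= ntP; exact: contrapT.
have [U [UU WU]] := ultraFilterLemma PW.
have UP : U P by apply: h => // B GB; apply: WU; apply: (@filterS _ G _ _ _ _ GB) => t Bt _.
have UnP : U (~` P) by apply: WU; exact: (@filterE _ G).
by apply: (@filter_not_empty _ U); rewrite -(setICr P); exact: filterI.
Qed.

(** * Estimates for finite products *)

Section RealProducts.
Variable R : realType.
Implicit Types (x t m : R) (s : seq R).

(** From exp(-x/2) >= 1 - x/2, since (1 + x)(1 - x/2) >= 1 on [0, 1]. *)
Lemma expR_half_le x : 0 <= x <= 1 -> expR (x / 2) <= 1 + x.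
Proof.
move=> /andP[x0 x1].
have h : expR (x / 2) * (1 - x / 2) <= 1.
  rewrite -[leRHS](expRxMexpNx_1 (x / 2)) ler_pM2l ?expR_gt0 //.
  exact: expR_ge1Dx.
have e0 := expR_gt0 (x / 2); nra.
Qed.

(** From exp(2x) >= 1 + 2x, since (1 - x)(1 + 2x) >= 1 on [0, 1/2]. *)
Lemma expRN2_le x : 0 <= x <= 1 / 2 -> expR (- (2 * x)) <= 1 - x.
Proof.
move=> /andP[x0 x1].
have h := expR_ge1Dx (2 * x).
have e1 := expRxMexpNx_1 (2 * x).
have e0 := expR_gt0 (- (2 * x)).
have e2 := expR_gt0 (2 * x).
rewrite -(ler_pM2l e2) e1; nra.
Qed.

Lemma prod1D_ge s t : 0 <= t -> {in s, forall m, 0 <= m} ->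
  1 + t * \sum_(m <- s) m <= \prod_(m <- s) (1 + t * m).
Proof.
move=> t0; elim: s => [|m s IH] sp; first by rewrite !big_nil mulr0 addr0.
rewrite !big_cons.
have m0 : 0 <= m by apply: sp; rewrite inE eqxx.
have sp' : {in s, forall m, 0 <= m} by move=> n ns; apply: sp; rewrite inE ns orbT.
have := IH sp'; have : 0 <= \sum_(i <- s) i by rewrite big_seq sumr_ge0.
set a := \sum_(i <- s) i; set b := \prod_(i <- s) _ => a0 ab.
have tm : 0 <= t * m by exact: mulr_ge0.
have ta : 0 <= t * a by exact: mulr_ge0.
nra.
Qed.

Lemma prod1D_expR s t : 0 <= t -> {in s, forall m, 0 <= m /\ t * m <= 1} ->
  expR (t / 2 * \sum_(m <- s) m) <= \prod_(m <- s) (1 + t * m).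
Proof.
move=> t0 sp; rewrite mulr_sumr expR_sum big_seq [leRHS]big_seq.
apply: ler_prod => m /sp[m0 tm1]; rewrite expR_ge0 /=.
by rewrite mulrAC expR_half_le // mulr_ge0.
Qed.

Lemma prod1B_expR s t : 0 <= t -> {in s, forall m, 0 <= m /\ t * m <= 1 / 2} ->
  expR (- (2 * t * \sum_(m <- s) m)) <= \prod_(m <- s) (1 - t * m).
Proof.
move=> t0 sp; rewrite mulr_sumr -sumrN expR_sum big_seq [leRHS]big_seq.
apply: ler_prod => m /sp[m0 tm1]; rewrite expR_ge0 /=.
by rewrite -mulrA expRN2_le // mulr_ge0.
Qed.

End RealProducts.

Section ComplexProducts.
Variable R : realType.
Implicit Types (u h : Cplx R) (s : seq R).

Definition cprod s u : Cplx R := \prod_(m <- s) (1 - u * m%:C).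

(** The derivative of [cprod s] at [u], unfolded by the product rule along the list. *)
Fixpoint dcprod s u : Cplx R :=
  if s is m :: s' then - m%:C * cprod s' u + (1 - u * m%:C) * dcprod s' u
  else 0.

Lemma cprod_cons m s u : cprod (m :: s) u = (1 - u * m%:C) * cprod s u.
Proof. by rewrite /cprod big_cons. Qed.

Lemma cprod_nil u : cprod [::] u = 1.
Proof. by rewrite /cprod big_nil. Qed.

Lemma cprod_cat s1 s2 u : cprod (s1 ++ s2) u = cprod s1 u * cprod s2 u.
Proof. by rewrite /cprod big_cat. Qed.

Lemma cprod_real s (x : R) : cprod s x%:C = (\prod_(m <- s) (1 - x * m))%:C.
Proof.
rewrite /cprod rmorph_prod; apply: eq_bigr => m _.
by rewrite rmorphB rmorphM rmorph1.
Qed.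

Lemma cabs_factor u (m rho : R) : 0 <= m -> cabs u <= rho ->
  cabs (1 - u * m%:C) <= 1 + rho * m.
Proof.
move=> m0 ur; apply: (le_trans (cabsD _ _)).
by rewrite cabs1 cabsN cabsM cabs_real ger0_norm // lerD2l ler_wpM2r.
Qed.

Lemma cabs_cprod s (rho : R) u : {in s, forall m, 0 <= m} -> cabs u <= rho ->
  cabs (cprod s u) <= expR (rho * \sum_(m <- s) m).
Proof.
move=> + ur; have r0 := le_trans (cabs_ge0 u) ur.
elim: s => [|m t IH] sp; first by rewrite cprod_nil cabs1 big_nil mulr0 expR0.
have m0 : 0 <= m by apply: sp; rewrite inE eqxx.
rewrite cprod_cons cabsM big_cons mulrDr expRD.
apply: ler_pM; rewrite ?cabs_ge0 //; last first.
  by apply: IH => n nt; apply: sp; rewrite inE nt orbT.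
exact: le_trans (cabs_factor m0 ur) (expR_ge1Dx _).
Qed.

(** Induction on the list, changing one factor at a time. The constant depends on [s] only through
    its sum, so it is uniform over lists of bounded total mass. *)
Lemma cprod_lip s (rho : R) u h : {in s, forall m, 0 <= m} ->
  cabs u <= rho -> cabs (u + h) <= rho ->
  cabs (cprod s (u + h) - cprod s u) <=
  cabs h * ((\sum_(m <- s) m) * expR (rho * \sum_(m <- s) m)).
Proof.
move=> + ur uhr; have r0 := le_trans (cabs_ge0 u) ur.
elim: s => [|m t IH] sp.
  by rewrite !cprod_nil subrr cabs0 big_nil mul0r mulr0.
have m0 : 0 <= m by apply: sp; rewrite inE eqxx.
have tp : {in t, forall m, 0 <= m} by move=> n nt; apply: sp; rewrite inE nt orbT.
have -> : cprod (m :: t) (u + h) - cprod (m :: t) u =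
    (1 - (u + h) * m%:C) * (cprod t (u + h) - cprod t u) + - (h * m%:C * cprod t u).
  by rewrite !cprod_cons; ring.
apply: (le_trans (cabsD _ _)); rewrite cabsN !cabsM cabs_real ger0_norm // big_cons.
have := IH tp; have := cabs_cprod tp ur; have := cabs_factor m0 uhr.
have : 0 <= \sum_(i <- t) i by rewrite big_seq sumr_ge0.
have := expR_ge1Dx (rho * m).
rewrite mulrDr expRD; set A := \sum_(i <- t) i; set e := expR (rho * A).
set e' := expR (rho * m).
have e0 : 0 < e := expR_gt0 _.
have h0 := cabs_ge0 h.
move=> e1 A0 f1 f2 f3.
have f4 : cabs (1 - (u + h) * m%:C) * cabs (cprod t (u + h) - cprod t u) <=
    e' * (cabs h * (A * e)).
  by apply: ler_pM; rewrite ?cabs_ge0 //; exact: le_trans e1.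
have f5 : cabs h * m * cabs (cprod t u) <= cabs h * m * e by rewrite ler_wpM2l // mulr_ge0.
have f6 : cabs h * m * e <= cabs h * m * (e' * e).
  rewrite ler_wpM2l ?mulr_ge0 // ler_peMl ?(ltW e0) // (le_trans _ e1) //.
  by rewrite lerDl mulr_ge0.
apply: (le_trans (lerD f4 (le_trans f5 f6))).
by rewrite le_eqVlt; apply/orP; left; apply/eqP; ring.
Qed.

(** The remainder is again controlled by the sum of [s] alone; it therefore survives a passage to
    the limit and yields differentiability there. *)
Lemma cprod_taylor s (rho : R) u h : {in s, forall m, 0 <= m} ->
  cabs u <= rho -> cabs (u + h) <= rho ->
  cabs (cprod s (u + h) - cprod s u - h * dcprod s u) <=
  cabs h ^+ 2 * ((\sum_(m <- s) m) ^+ 2 * expR (rho * \sum_(m <- s) m)).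
Proof.
move=> + ur uhr; have r0 := le_trans (cabs_ge0 u) ur.
elim: s => [|m t IH] sp.
  by rewrite !cprod_nil /= mulr0 subrr subr0 cabs0 big_nil expr0n mul0r mulr0.
have m0 : 0 <= m by apply: sp; rewrite inE eqxx.
have tp : {in t, forall m, 0 <= m} by move=> n nt; apply: sp; rewrite inE nt orbT.
have -> : cprod (m :: t) (u + h) - cprod (m :: t) u - h * dcprod (m :: t) u =
    (1 - u * m%:C) * (cprod t (u + h) - cprod t u - h * dcprod t u)
    + - (h * m%:C * (cprod t (u + h) - cprod t u)).
  by rewrite !cprod_cons /=; ring.
apply: (le_trans (cabsD _ _)); rewrite cabsN !cabsM cabs_real ger0_norm // big_cons.
have := IH tp; have := cprod_lip tp ur uhr; have := cabs_factor m0 ur.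
have : 0 <= \sum_(i <- t) i by rewrite big_seq sumr_ge0.
have := expR_ge1Dx (rho * m).
rewrite mulrDr expRD; set A := \sum_(i <- t) i; set e := expR (rho * A).
set e' := expR (rho * m).
have e0 : 0 < e := expR_gt0 _.
have h0 := cabs_ge0 h.
move=> e1 A0 f1 f2 f3.
have e1' : 1 <= e' by apply: le_trans e1; rewrite lerDl mulr_ge0.
have f4 : cabs (1 - u * m%:C) * cabs (cprod t (u + h) - cprod t u - h * dcprod t u) <=
    e' * (cabs h ^+ 2 * (A ^+ 2 * e)).
  by apply: ler_pM; rewrite ?cabs_ge0 //; exact: le_trans e1.
have f5 : cabs h * m * cabs (cprod t (u + h) - cprod t u) <=
    cabs h * m * (cabs h * (A * e)) by rewrite ler_wpM2l // mulr_ge0.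
have f6 : cabs h * m * (cabs h * (A * e)) <= cabs h * m * (cabs h * (A * e)) * e'.
  by rewrite ler_peMr // !mulr_ge0 // ltW.
apply: (le_trans (lerD f4 (le_trans f5 f6))).
rewrite -subr_ge0.
set lhs := (X in 0 <= X).
have -> : lhs = cabs h ^+ 2 * (e' * e) * (m ^+ 2 + m * A) by rewrite /lhs; ring.
apply: mulr_ge0; last by rewrite addr_ge0 ?sqr_ge0 ?mulr_ge0.
by apply: mulr_ge0; [exact: sqr_ge0|exact: mulr_ge0 (expR_ge0 _) (expR_ge0 _)].
Qed.

End ComplexProducts.

(** * Limits and differentiability in the complex plane *)

Section ComplexCvg.
Variables (R : realType) (T : Type).
Implicit Types (u v : T -> Cplx R) (G : set_system T).

Lemma cvgC_unique G {PG : ProperFilter G} u (l l' : Cplx R) :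
  u @ G --> l -> u @ G --> l' -> l = l'.
Proof. exact: (cvg_unique (@norm_hausdorff _ (Cplx R))). Qed.

(* The generic [cvgB] and [cvgM] with the codomain given explicitly: inferring
   the structures on [Cplx R] by unification does not terminate. *)
Lemma cvgCB G {PG : ProperFilter G} u v (l m : Cplx R) :
  u @ G --> l -> v @ G --> m -> (fun k => u k - v k) @ G --> l - m.
Proof. by move=> ul vm; exact (@cvgB (Cplx R) (Cplx R) _ _ _ u v l m ul vm). Qed.

Lemma cvgCM G {PG : ProperFilter G} u v (l m : Cplx R) :
  u @ G --> l -> v @ G --> m -> (fun k => u k * v k) @ G --> l * m.
Proof. by move=> ul vm; exact (@cvgM (Cplx R) _ _ _ u v l m ul vm). Qed.

Lemma cvgC_cst G {PG : ProperFilter G} (l : Cplx R) : (fun=> l : Cplx R) @ G --> l.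
Proof. exact (@cvg_cst (Cplx R) l T G _). Qed.

Lemma cvgCX G {PG : ProperFilter G} u (l : Cplx R) n :
  u @ G --> l -> (fun k => u k ^+ n) @ G --> l ^+ n.
Proof.
move=> ul; elim: n => [|n IH]; first exact: cvgC_cst.
rewrite exprS (_ : (fun k => _) = (fun k => u k * u k ^+ n)); first exact: (cvgCM ul IH).
by apply/funext => k; rewrite exprS.
Qed.

Lemma cvg_cabs_dist G {PG : ProperFilter G} u v (w : T -> R) (l : Cplx R) :
  v @ G --> l -> w @ G --> (0 : R) ->
  (\forall k \near G, cabs (u k - v k) <= w k) -> u @ G --> l.
Proof.
move=> /cvg_cabsP vl w0 uvw; apply/cvg_cabsP.
have h : (fun k => w k + cabs (v k - l)) @ G --> (0 : R).
  by rewrite -[X in _ --> X](addr0 (0 : R)); exact: cvgD.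
apply: (squeeze_cvgr _ _ h); last exact: cvg_cst.
apply: filterS uvw => k uvk; rewrite cabs_ge0 /=.
apply: le_trans (lerD uvk (lexx _)).
by rewrite -[X in cabs X](_ : u k - v k + (v k - l) = _) ?cabsD // addrA subrK.
Qed.

Lemma derivable_quadratic (g : Cplx R -> Cplx R) (u D : Cplx R) (C : R) :
  (forall h, cabs h <= 1 -> cabs (g (u + h) - g u - h * D) <= C * cabs h ^+ 2) ->
  derivable g u 1.
Proof.
move=> gC; apply/cvg_ex; exists D; apply/cvg_cabsP.
have C0 : 0 <= C.
  by have := gC 1; rewrite cabs1 lexx expr1n mulr1 => /(_ isT); exact/le_trans/cabs_ge0.
apply/cvgrPdist_lt => e e0.
(* On this radius C |h| < e; the denominator C + 1 stays positive even when C = 0. *)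
pose r := Num.min 1 (e / (C + 1)).
have r0 : 0 < r by rewrite lt_min ltr01 divr_gt0 // ltr_wpDl.
have r0C : 0 < (r%:C : Cplx R) by rewrite ltcR.
have := dnbhs0_lt (V := Cplx R) r0C; apply: filter_app.
have := nbhs_dnbhs_neq (0 : Cplx R); apply: filterS => h h0.
rewrite normCabs ltcR lt_min => /andP[h1 he].
rewrite sub0r normrN ger0_norm ?cabs_ge0 //.
have hp : 0 < cabs h by rewrite lt_neqAle cabs_ge0 eq_sym cabs_eq0 h0.
have -> : h^-1 *: ((g \o shift u) (h *: 1) - g u) - D
    = h^-1 * (g (u + h) - g u - h * D).
  rewrite /GRing.scale /= mulr1 (addrC h) [RHS]mulrBr; congr (_ - _).
  by rewrite mulrA mulVf ?mul1r.
rewrite -(ltr_pM2l hp) -cabsM mulrA divff // mul1r.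
apply: (le_lt_trans (gC _ (ltW h1))).
rewrite expr2 mulrCA ltr_pM2l //.
move: he; rewrite ltr_pdivlMr ?ltr_wpDl //; apply: le_lt_trans.
by rewrite mulrC ler_wpM2l ?cabs_ge0 // lerDl.
Qed.

End ComplexCvg.

Arguments cvgC_cst {R T G PG} l.
Arguments cvgCX {R T G PG u l} n _.

(** * Ultrafilter limits of products with bounded total mass *)

Section UltraProducts.
Variables (R : realType) (U : set_system nat).
Context {UU : UltraFilter U}.
Variables (M : nat -> seq R) (K : R).
Hypothesis M_ge0 : forall k, {in M k, forall m, 0 <= m}.
Hypothesis M_le : forall k, \sum_(m <- M k) m <= K.

Let sum_ge0 k : 0 <= \sum_(m <- M k) m.
Proof. by rewrite big_seq sumr_ge0 // => m /M_ge0. Qed.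

Let K_ge0 : 0 <= K.
Proof. exact: le_trans (sum_ge0 0) (M_le 0). Qed.

Let expR_le k (rho : R) : 0 <= rho ->
  expR (rho * \sum_(m <- M k) m) <= expR (rho * K).
Proof. by move=> r0; rewrite ler_expR ler_wpM2l. Qed.

Lemma cabs_cprod_bounded k u (rho : R) : cabs u <= rho ->
  cabs (cprod (M k) u) <= expR (rho * K).
Proof.
move=> ur; have r0 := le_trans (cabs_ge0 u) ur.
exact: le_trans (cabs_cprod (@M_ge0 k) ur) (expR_le _ r0).
Qed.

(** Boundedness gives the pointwise limits, and the Taylor estimate, whose constant does not depend
    on [k], passes to them. *)
Lemma cprod_ultra_cvg : exists g : Cplx R -> Cplx R,
  (forall u, (fun k => cprod (M k) u) @ U --> g u) /\
  forall u, derivable g u 1.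
Proof.
have /choice[g gP] : forall u, exists l : Cplx R, (fun k => cprod (M k) u) @ U --> l.
  by move=> u; apply: ultra_bounded_cvgC => k; exact: cabs_cprod_bounded (lexx _).
exists g; split; first exact: gP.
move=> u.
pose rho := cabs u + 1.
have ur : cabs u <= rho by rewrite lerDl.
have uhr h : cabs h <= 1 -> cabs (u + h) <= rho.
  by move=> h1; apply: (le_trans (cabsD _ _)); rewrite lerD2l.
have r0 := le_trans (cabs_ge0 u) ur.
pose C := K ^+ 2 * expR (rho * K).
have taylor k h : cabs h <= 1 ->
    cabs (cprod (M k) (u + h) - cprod (M k) u - h * dcprod (M k) u) <= C * cabs h ^+ 2.
  move=> h1; apply: (le_trans (cprod_taylor (@M_ge0 k) ur (uhr _ h1))).
  rewrite mulrC ler_wpM2r ?sqr_ge0 //; apply: ler_pM; rewrite ?sqr_ge0 ?expR_ge0 //.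
    by rewrite lerXn2r // nnegrE.
  exact: expR_le.
(* The derivatives are bounded by the Taylor estimate at h = 1, so they converge along [U]. *)
have [D DP] : exists D : Cplx R, (fun k => dcprod (M k) u) @ U --> D.
  apply: (@ultra_bounded_cvgC _ _ _ _ _ (expR (rho * K) + expR (rho * K) + C)) => k.
  have := taylor k 1; rewrite cabs1 lexx expr1n mulr1 mul1r => /(_ isT) t1.
  rewrite -[dcprod _ _](_ : cprod (M k) (u + 1) - cprod (M k) u -
    (cprod (M k) (u + 1) - cprod (M k) u - dcprod (M k) u) = _); last by ring.
  apply: (le_trans (cabsD _ _)); rewrite cabsN; apply: lerD => //.
  apply: (le_trans (cabsD _ _)); rewrite cabsN.
  by apply: lerD; apply: cabs_cprod_bounded => //; apply: uhr; rewrite cabs1.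
apply: (@derivable_quadratic _ _ _ D C) => h h1.
apply: (@cvgr_to_le _ U _ _
  (fun k => cabs (cprod (M k) (u + h) - cprod (M k) u - h * dcprod (M k) u))).
  apply: cvg_cabs; apply: cvgCB; first exact: (cvgCB (gP _) (gP _)).
  exact (cvgCM (cvgC_cst h) DP).
by apply: filterE => k; exact: taylor.
Qed.

(** The uniform Lipschitz bound absorbs the displacement of the argument; it serves to replace
    [cversin (d k) z] by its limit z^2. *)
Lemma cprod_cvg_moving (v : nat -> Cplx R) (u l : Cplx R) :
  v @ U --> u -> (fun k => cprod (M k) u) @ U --> l ->
  (fun k => cprod (M k) (v k)) @ U --> l.
Proof.
move=> vu ul.
pose C := K * expR ((cabs u + 1) * K).
apply: (@cvg_cabs_dist _ _ _ _ _ _ (fun k => cabs (v k - u) * C) _ ul).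
  by rewrite -(mul0r C); apply: cvgM; [apply/cvg_cabsP|exact: cvg_cst].
move/cvg_cabsP/cvgr_lt : vu => /(_ 1 ltr01); apply: filterS => k vk1.
have /(cprod_lip (@M_ge0 k)) h : cabs u <= cabs u + 1 by rewrite lerDl.
have e : u + (v k - u) = v k by rewrite addrC subrK.
move: (h (v k - u)); rewrite e => /(_ _)/le_trans -> //.
  by rewrite -e (le_trans (cabsD _ _)) // lerD2l ltW.
rewrite ler_wpM2l ?cabs_ge0 //; apply: ler_pM; rewrite ?expR_ge0 //.
by rewrite expR_le // addr_ge0 ?cabs_ge0.
Qed.

End UltraProducts.

(** * Cosine polynomials as products *)

Section CosinePolynomial.
Variable R : realType.
Implicit Types (d x y : R) (z v : Cplx R) (Q : {poly R}).

(** The function w_k of the opening comment, for d = d_k. *)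
Definition cversin d z : Cplx R := (2 / d ^+ 2)%:C * (1 - ccos (d%:C * z)).

Lemma ccosE x y : ccos (x +i* y) =
  ((expR (- y) + expR y) / 2 * cos x) +i* ((expR (- y) - expR y) / 2 * sin x) :> Cplx R.
Proof.
have e : ci R * (x +i* y) = (- y) +i* x :> Cplx R.
  by apply/eqP; rewrite eq_complex /= !mul0r !mul1r ?sub0r ?add0r !eqxx.
rewrite /ccos e /cexp /= opprK cosN sinN.
apply: (mulIf (_ : 2 != 0 :> Cplx R)); first by rewrite pnatr_eq0.
rewrite divfK ?pnatr_eq0 // mulr_natr mulr2n.
by apply/eqP; rewrite eq_complex /=; apply/andP; split; apply/eqP; field.
Qed.

Lemma ccos0 : ccos (0 : Cplx R) = 1.
Proof. by have := ccos_real (0 : R); rewrite cos0. Qed.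

(** A root x contributes (cos(dz) - x) / (1 - x) = 1 - w m with w = [cversin d z] and m = d^2 / (2
    (1 - x)). Here x < 1 allows the division and x >= -1 gives m >= d^2 / 4. *)
Lemma cos_poly_product Q n d : 0 < d -> size Q = n.+1 ->
  (forall z : Cplx R, root (map_poly (real_complex R) Q) z ->
     exists2 x : R, -1 <= x < 1 & z = x%:C) ->
  exists s : seq R, [/\ size s = n, sorted >=%R s,
    {in s, forall m, d ^+ 2 / 4 <= m} &
    forall z, (map_poly (real_complex R) Q).[ccos (d%:C * z)] =
      (map_poly (real_complex R) Q).[1] * cprod s (cversin d z)].
Proof.
move=> d0 sQ rQ; set P := map_poly _ Q.
have [rs Prs] := closed_field_poly_normal P.
have P0 : P != 0 by rewrite map_poly_eq0 -size_poly_eq0 sQ.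
have lP0 : lead_coef P != 0 by rewrite lead_coef_eq0.
have rootP z : root P z = (z \in rs).
  by rewrite Prs rootZ // root_prod_XsubC.
have srs : size rs = n.
  have : size P = n.+1 by rewrite size_map_poly.
  by rewrite Prs size_scale // size_prod_XsubC => -[].
have rsP z : z \in rs -> exists2 x : R, -1 <= x < 1 & z = x%:C.
  by rewrite -rootP; exact: rQ.
pose mu (z : Cplx R) := d ^+ 2 / (2 * (1 - complex.Re z)).
exists (sort >=%R (map mu rs)); split.
- by rewrite size_sort size_map.
- by apply: sort_sorted => a b; exact: le_total.
- move=> m; rewrite mem_sort => /mapP[z /rsP[x /andP[x1 x2] ->] ->].
  rewrite /mu /= ler_pM2l ?exprn_gt0 // lef_pV2 ?posrE ?mulr_gt0 ?subr_gt0 //; lra.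
- move=> z; rewrite /cprod (perm_big _ (permEl (perm_sort _ _))).
  rewrite big_map [in LHS]Prs [in X in _ = X * _]Prs !hornerZ -mulrA; congr (_ * _).
  rewrite !horner_prod -big_split /= big_seq [RHS]big_seq.
  apply: eq_bigr => w /rsP[x /andP[x1 x2] ->].
  rewrite !hornerXsubC /mu /=.
  have d1 : (d%:C : Cplx R) != 0 by rewrite eq_complex /= eqxx andbT gt_eqF.
  have x3 : (1 - x%:C : Cplx R) != 0.
    by rewrite -(rmorph1 (real_complex R)) -rmorphB eq_complex /= eqxx andbT gt_eqF // subr_gt0.
  rewrite /cversin !(rmorphM, fmorphV, rmorphB, rmorphXn, rmorph1, rmorph_nat) /=.
  by field; rewrite d1 x3.
Qed.

(** On the imaginary axis the cosine is a hyperbolic cosine, and cosh t - 1 = 2 sinh(t/2)^2. *)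
Lemma cversin_imag d y :
  cversin d (0 +i* y) = (- (((expR (d * y / 2) - expR (- (d * y / 2))) / d) ^+ 2))%:C.
Proof.
rewrite /cversin; have -> : d%:C * (0 +i* y) = 0 +i* (d * y) :> Cplx R.
  by apply/eqP; rewrite eq_complex /= !mul0r !mulr0 ?subr0 ?addr0 !eqxx.
rewrite ccosE cos0 sin0 !mulr0 mulr1 complexr0.
rewrite -(rmorph1 (real_complex R)) -rmorphB -rmorphM; congr (_%:C).
have -> : expR (d * y) = expR (d * y / 2) ^+ 2 by rewrite expr2 -expRD; congr expR; field.
have -> : expR (- (d * y)) = expR (- (d * y / 2)) ^+ 2 by rewrite expr2 -expRD; congr expR; field.
have := expRxMexpNx_1 (d * y / 2); set a := expR _; set b := expR _ => ab.
(* At d = 0 both sides vanish because the inverse of 0 is 0. *)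
have [->|d0] := eqVneq d 0; first by rewrite expr0n /= invr0 !mulr0 mul0r expr0n oppr0.
transitivity (2 / d ^+ 2 * (a * b - (b ^+ 2 + a ^+ 2) / 2)); last by field.
by rewrite ab ?mulr1.
Qed.

(** Since exp(d/2) >= 1 + d/2 and exp(-d/2) <= 1, the quotient being squared is at least 1/2,
    whatever d is. This is what bounds the total masses. *)
Lemma cversin_imag_ge d : 0 < d -> exists2 t, 1 / 4 <= t & cversin d (0 +i* 1) = (- t)%:C.
Proof.
move=> d0; rewrite cversin_imag mulr1; eexists; last reflexivity.
have h1 := expR_ge1Dx (d / 2); have := expRxMexpNx_1 (d / 2).
set a := expR (d / 2) in h1 *; set b := expR _ => ab.
have a0 : 0 < a := expR_gt0 _.
have b0 : 0 < b := expR_gt0 _.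
have b1 : b <= 1 by nra.
have h : 1 / 2 <= (a - b) / d by rewrite ler_pdivlMr //; lra.
by have : 0 <= (a - b) / d; nra.
Qed.

End CosinePolynomial.

(** * Convergence of the rescaled cosine to z^2 *)

Section CversinCvg.
Variables (R : realType) (G : set_system nat).
Context {PG : ProperFilter G}.
Variable d : nat -> R.
Hypothesis d_cvg : d @ G --> (0 : R).
Hypothesis d_gt0 : \forall k \near G, 0 < d k.

Lemma slope_cvg (g : R -> R) (a : R) : is_derive (0 : R) 1 g a -> g 0 = 0 ->
  (fun k => g (d k) / d k) @ G --> a.
Proof.
move=> [dg <-] g0; apply/cvgrPdist_lt => e e0.
move/cvgrPdist_lt : dg => /(_ e e0) /= /nbhs_ballP[r /= r0 hr].
have hd : \forall k \near G, `|0 - d k| < r by move/cvgrPdist_lt: d_cvg; exact.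
apply: filterS2 d_gt0 hd => k dk0 dkr.
have -> : g (d k) / d k = (d k)^-1 *: ((g \o shift 0) (d k *: 1) - g 0).
  by rewrite /GRing.scale /= mulr1 addr0 g0 subr0 mulrC.
exact: hr dkr (lt0r_neq0 dk0).
Qed.

Lemma sin_slope_cvg (x : R) : (fun k => sin (d k * x) / d k) @ G --> x.
Proof.
apply: (slope_cvg (g := fun t => sin (t * x))); last by rewrite mul0r sin0.
apply: is_derive_eq; rewrite mul0r cos0 /GRing.scale /=.
ring.
Qed.

Lemma expR_slope_cvg (y : R) :
  (fun k => (expR (d k * y) - expR (- (d k * y))) / d k) @ G --> 2 * y.
Proof.
apply: (slope_cvg (g := fun t => expR (t * y) - expR (- (t * y)))).
  by apply: is_derive_eq; rewrite mul0r oppr0 expR0 /GRing.scale /=; ring.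
by rewrite mul0r oppr0 subrr.
Qed.

Lemma cversin_cvg (z : Cplx R) : (fun k => cversin (d k) z) @ G --> z ^+ 2.
Proof.
case: z => x y.
pose E k := (expR (d k * (y / 2)) - expR (- (d k * (y / 2)))) / d k.
pose E2 k := (expR (d k * y) - expR (- (d k * y))) / d k.
pose S k := sin (d k * (x / 2)) / d k.
pose S2 k := sin (d k * x) / d k.
have Ey : E @ G --> y.
  have -> : y = 2 * (y / 2) by field.
  have -> : E = (fun k => (expR (d k * (y / 2)) - expR (- (d k * (y / 2)))) / d k) by [].
  exact: expR_slope_cvg.
have E2y : E2 @ G --> 2 * y := @expR_slope_cvg y.
have Sx : S @ G --> x / 2 := @sin_slope_cvg (x / 2).
have S2x : S2 @ G --> x := @sin_slope_cvg x.
(* [A] and [B] are the real and imaginary parts of [cversin (d k) z], written by the half-angle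
   formulas cos(dx) = 1 - 2 d^2 S^2 and cosh(dy) = 1 + d^2 E^2 / 2 in terms of quotients with known
   limits. *)
pose A k := 4 * (S k * S k) - E k * E k + 2 * (d k * d k) * (E k * E k) * (S k * S k).
pose B k := E2 k * S2 k.
have Ax : A @ G --> x ^+ 2 - y ^+ 2.
  have -> : x ^+ 2 - y ^+ 2 = 4 * (x / 2 * (x / 2)) - y * y
      + 2 * (0 * 0) * (y * y) * (x / 2 * (x / 2)) by field.
  apply: cvgD; first (apply: cvgB; last exact: cvgM).
    by apply: cvgM; [exact: cvg_cst|exact: cvgM].
  apply: cvgM; last exact: cvgM.
  apply: cvgM; last exact: cvgM.
  by apply: cvgM; [exact: cvg_cst|exact: cvgM].
have Bx : B @ G --> 2 * y * x by exact: cvgM.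
have -> : (x +i* y) ^+ 2 = (x ^+ 2 - y ^+ 2) +i* (2 * y * x) :> Cplx R.
  by apply/eqP; rewrite expr2 eq_complex /=; apply/andP; split; apply/eqP; ring.
have AB := cvg_ReIm Ax Bx.
apply: (@cvg_cabs_dist _ _ _ _ _ _ (fun=> 0) _ (AB _)); first exact: cvg_cst.
apply: filterS d_gt0 => k dk0; rewrite le_eqVlt cabs_eq0 subr_eq0; apply/orP; left.
rewrite /cversin; have -> : (d k)%:C * (x +i* y) = (d k * x) +i* (d k * y) :> Cplx R.
  by apply/eqP; rewrite eq_complex /= !mul0r ?subr0 ?addr0 !eqxx.
apply/eqP; rewrite /A /B ccosE /E /E2 /S /S2.
have dn0 : d k != 0 by rewrite gt_eqF.
have -> : cos (d k * x) = 1 - 2 * sin (d k * (x / 2)) ^+ 2.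
  have -> : d k * x = (d k * (x / 2)) *+ 2 by rewrite mulr2n; field.
  by rewrite cos_mulr2n; have := cos2Dsin2 (d k * (x / 2)); lra.
rewrite !expRN.
set e := expR (d k * y); have -> : e = expR (d k * (y / 2)) ^+ 2.
  by rewrite /e expr2 -expRD; congr expR; field.
have : expR (d k * (y / 2)) != 0 by rewrite gt_eqF ?expR_gt0.
set a := expR _; set s := sin (d k * (x / 2)); set s2 := sin _ => a0.
apply/eqP; rewrite eq_complex /=; apply/andP; split; apply/eqP.
  by field; rewrite dn0 a0.
by field; rewrite dn0 a0.
Qed.
End CversinCvg.

(** * Zeros and order of growth *)

Section Listings.
Variable R : realType.
Implicit Types (F : Cplx R -> Cplx R) (a : Cplx R) (I J : set nat) (gamma delta : nat -> R).

Lemma derivable_cvg_dnbhs F a : derivable F a 1 -> F z @[z --> a^'] --> F a.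
Proof.
move=> /derivable1_diffP/differentiable_continuous Fa.
exact: cvg_trans (cvg_app F (@nbhs_dnbhs _ a)) Fa.
Qed.

(** Cancelling (z - a)^m off the point gives G(z) = (z - a)^(n - m) H(z), which tends to 0 at a when
    m < n, while G(a) is nonzero. *)
Lemma vanishing_order_ltF F a m n :
  vanishing_order F a m -> vanishing_order F a n -> ~ (m < n)%N.
Proof.
move=> [G [dG Ga FG]] [H [dH Ha FH]] mn; move/negP: Ga; apply; apply/eqP.
have PD : ProperFilter (a^') := Proper_dnbhs_numFieldType a.
have Gc := derivable_cvg_dnbhs (nbhs_singleton dG).
have Hc := derivable_cvg_dnbhs (nbhs_singleton dH).
have zc : z @[z --> a^'] --> a := @nbhs_dnbhs _ a.
have zac : (z - a) @[z --> a^'] --> a - a by exact: (cvgCB zc (cvgC_cst a)).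
have Rc : (fun z : Cplx R => (z - a) ^+ (n - m)%N * H z) @ a^' --> (a - a) ^+ (n - m)%N * H a.
  exact (cvgCM (cvgCX (n - m)%N zac) Hc).
have GR : \forall z \near a^', cabs (G z - (z - a) ^+ (n - m)%N * H z) <= 0.
  have := nbhs_dnbhs_neq a; apply: filter_app.
  have := nbhs_dnbhs FH; apply: filter_app.
  have := nbhs_dnbhs FG; apply: filterS => z FGz FHz za.
  rewrite le_eqVlt cabs_eq0 subr_eq0; apply/orP; left; apply/eqP.
  have zam : (z - a) ^+ m != 0 by rewrite expf_eq0 subr_eq0 (negbTE za) andbF.
  by apply: (mulfI zam); rewrite mulrA -exprD subnKC ?(ltnW mn) // -FGz -FHz.
have Gc' : G z @[z --> a^'] --> (a - a) ^+ (n - m)%N * H a.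
  by apply: (cvg_cabs_dist Rc _ GR); exact: cvg_cst.
by rewrite (cvgC_unique Gc Gc') subrr expr0n subn_eq0 leqNgt mn mul0r.
Qed.

Lemma vanishing_order_unique F a m n :
  vanishing_order F a m -> vanishing_order F a n -> m = n.
Proof.
move=> Fm Fn; case: (ltngtP m n) => [mn|nm|->]; last reflexivity.
- by case: (vanishing_order_ltF Fm Fn mn).
- by case: (vanishing_order_ltF Fn Fm nm).
Qed.

(** Each x > 0 is listed as often as its order of vanishing, so the fibres over x are in bijection;
    these bijections are glued along the values. *)
Lemma listing_set_bij F I gamma J delta :
  lists_positive_zeros F I gamma -> lists_positive_zeros F J delta ->
  exists h, set_bij I J h /\ forall n, I n -> delta (h n) = gamma n.
Proof.
move=> [_ I0 _ Im] [_ J0 _ Jm].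
have /choice[h hP] : forall x : R, exists h : nat -> nat, 0 < x ->
    set_bij [set n | I n /\ gamma n = x] [set n | J n /\ delta n = x] h.
  move=> x; have [x0|nx] := pselect (0 < x); last by exists id.
  have [m Ixm Fm] := Im x x0; have [n Jxn Fn] := Jm x x0.
  have mn := vanishing_order_unique Fm Fn; subst n.
  have /card_set_bijP[h hb] := card_eq_trans Ixm (etrans (card_eq_sym _ _) Jxn).
  by exists h.
exists (fun n => h (gamma n) n); split; last first.
  by move=> n In; have [/(_ n (conj In erefl)) []] := hP _ (I0 n In).
split.
- by move=> n In; have [/(_ n (conj In erefl)) []] := hP _ (I0 n In).
- move=> m n; rewrite !inE => Im' In e.
  have [fm _ _] := hP _ (I0 m Im'); have [fn injn _] := hP _ (I0 n In).
  have [_ dm] := fm m (conj Im' erefl); have [_ dn] := fn n (conj In erefl).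
  have g : gamma m = gamma n by rewrite -dm -dn e.
  by apply: injn; rewrite ?inE; [split|split|rewrite -e g].
- move=> j Jj; have [_ _ /(_ j (conj Jj erefl)) [n [In gn] hn]] := hP _ (J0 j Jj).
  by exists n => //; rewrite gn.
Qed.

Lemma esum_listing F I gamma J delta (phi : R -> \bar R) :
  lists_positive_zeros F I gamma -> lists_positive_zeros F J delta ->
  \esum_(n in I) phi (gamma n) = \esum_(n in J) phi (delta n).
Proof.
move=> FI FJ; have [h [hb hg]] := listing_set_bij FI FJ.
rewrite (reindex_esum _ _ _ _ hb); apply: eq_esum => n In.
by rewrite hg.
Qed.

(** Sums over zeros depend on [F] alone, so an arbitrary listing can be exchanged for the one built
    from the limit masses. Nonnegativity turns the series into an unordered sum, which can be
    reindexed. *)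
Lemma nneseries_listing F I gamma J delta (P : R -> bool) (phi : R -> \bar R) :
  (forall x, (0 <= phi x)%E) ->
  lists_positive_zeros F I gamma -> lists_positive_zeros F J delta ->
  (\sum_(n <oo | (n \in I) && P (gamma n)) phi (gamma n) =
   \sum_(n <oo | (n \in J) && P (delta n)) phi (delta n))%E.
Proof.
move=> phi0 FI FJ; rewrite !nneseries_esum //.
have e (A : set nat) (f : nat -> R) :
    (\esum_(n in [set n | (n \in A) && P (f n)]) phi (f n) =
     \esum_(n in A) (if P (f n) then phi (f n) else 0))%E.
  rewrite (_ : [set n | _] = A `&` [set n | P (f n)]); last first.
    apply/seteqP; split=> n /=; first by move/andP=> []; rewrite inE.
    by move=> [An ->]; rewrite andbT inE.
  by rewrite esum_mkcondr; apply: eq_esum => n _; rewrite mem_setE.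
rewrite !e; exact: (esum_listing (fun x => if P x then phi x else 0%E) FI FJ).
Qed.

End Listings.

(** * Lower bound for the order of growth *)

Section GrowthOrder.
Variable R : realType.
Variables (F : Cplx R -> Cplx R) (b lam : R).
Hypothesis F_bounded : forall r : R, exists B, forall z, cabs z = r -> cabs (F z) <= B.
Hypotheses (b_gt0 : 0 < b) (lam_gt0 : 0 < lam).
Hypothesis F_ge : forall y : R, 0 < y -> b * expR (lam * y ^+ 2) <= cabs (F (0 +i* y)).

Lemma maxmod_ge (y : R) : 0 < y -> b * expR (lam * y ^+ 2) <= maxmod F y.
Proof.
(* A [sup] dominates the members of its set once that set is bounded above, whence [F_bounded]. *)
move=> y0; apply: (le_trans (F_ge y0)); apply: ub_le_sup.
  by have [B FB] := F_bounded y; exists B => _ [z /= zy <-]; exact: FB.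
by exists (0 +i* y) => //=; rewrite /cabs /= expr0n add0r sqrtr_sqr gtr0_norm.
Qed.

(** Half of the exponent lam y^2 absorbs the constant ln b. *)
Lemma lnln_maxmod_ge (y : R) : 1 <= y -> 2 * `|ln b| / lam <= y ->
  ln (lam / 2) + 2 * ln y <= ln (ln (maxmod F y)).
Proof.
move=> y1 yb.
have y0 : 0 < y by exact: lt_le_trans y1.
have y2 : y <= y ^+ 2 by rewrite expr2 ler_peMl // ltW.
have M0 : 0 < b * expR (lam * y ^+ 2) by rewrite mulr_gt0 ?expR_gt0.
have M1 := maxmod_ge y0.
have lnb_le : ln b + lam * y ^+ 2 <= ln (maxmod F y).
  rewrite -[X in _ + X]expRK -lnM ?posrE ?expR_gt0 //.
  by rewrite ler_ln ?posrE // (lt_le_trans M0).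
have hb : - ln b <= lam / 2 * y ^+ 2.
  have : 2 * `|ln b| <= lam * y.
    by move: yb; rewrite ler_pdivrMr // (mulrC y).
  have := ler_norm (- ln b); rewrite normrN.
  have : lam * y <= lam * y ^+ 2 by rewrite ler_pM2l.
  lra.
have h2 : lam / 2 * y ^+ 2 <= ln (maxmod F y) by lra.
have p2 : 0 < lam / 2 * y ^+ 2 by rewrite !mulr_gt0 // ?exprn_gt0 // invr_gt0.
have -> : 2 * ln y = ln (y ^+ 2) by rewrite lnXn // mulr_natl.
rewrite -lnM ?posrE ?divr_gt0 ?exprn_gt0 //.
by rewrite ler_ln ?posrE // (lt_le_trans p2).
Qed.

(** The bound excludes constants. Otherwise the limit superior is an infimum of suprema over
    neighbourhoods of infinity, and each of these contains a y where the quotient is at least 2 -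
    e. *)
Lemma growth_order_ge2 : (2%:E <= growth_order F)%E.
Proof.
rewrite /growth_order asboolF; last first.
  move=> [c Fc].
  (* Chosen so that b lam y = b lam + |c|; as y >= 1, the lower bound at y exceeds |c|. *)
  pose y := 1 + cabs c / (b * lam).
  have bl : 0 < b * lam by exact: mulr_gt0.
  have q0 : 0 <= cabs c / (b * lam) by rewrite divr_ge0 ?cabs_ge0 // ltW.
  have y0 : 0 < y by rewrite ltr_pwDl.
  have := F_ge y0; rewrite Fc; apply/negP; rewrite -ltNge.
  have h1 := expR_ge1Dx (lam * y ^+ 2).
  have h2 : cabs c = (cabs c / (b * lam)) * (b * lam) by rewrite divfK // gt_eqF.
  have h3 : b * (1 + lam * y ^+ 2) <= b * expR (lam * y ^+ 2) by rewrite ler_pM2l.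
  apply: lt_le_trans h3; rewrite h2.
  have y1 : 1 <= y by rewrite /y lerDl.
  have h4 : y <= y ^+ 2 by rewrite expr2 ler_peMl // ltW.
  have h5 : b * lam * y <= b * lam * y ^+ 2 by rewrite ler_pM2l.
  have h6 : b * lam * y = b * lam + cabs c / (b * lam) * (b * lam).
    by rewrite /y mulrDr mulr1 (mulrC (b * lam)).
  rewrite (mulrDr b) mulr1 (mulrA b lam).
  apply: (@le_lt_trans _ _ (b * lam * y ^+ 2)); last by rewrite ltrDr b_gt0.
  by apply: le_trans h5; rewrite h6 lerDr ltW.
apply: le_ereal_inf_tmp => _ [V [M [_ MV]] <-].
apply/lee_subgt0Pr => e e0; rewrite -EFinB.
(* The three terms put y in the neighbourhood, make e ln y dominate |ln (lam / 2)| with ln y > 0,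
   and meet the condition of [lnln_maxmod_ge]. *)
pose y := Num.max (M + 1) (Num.max (expR (1 + `|ln (lam / 2)| / e)) (2 * `|ln b| / lam)).
have yM : M < y by rewrite lt_max ltrDl ltr01.
have ye : expR (1 + `|ln (lam / 2)| / e) <= y by rewrite !le_max lexx orbT.
have yb : 2 * `|ln b| / lam <= y by rewrite !le_max lexx !orbT.
have q0 : 0 <= `|ln (lam / 2)| / e by rewrite divr_ge0 // ltW.
have y1 : 1 <= y.
  apply: le_trans ye; apply: le_trans (expR_ge1Dx _); lra.
have y0 : 0 < y by exact: lt_le_trans y1.
have ly : 1 + `|ln (lam / 2)| / e <= ln y.
  by rewrite -[leLHS]expRK ler_ln ?posrE ?expR_gt0.
have ly0 : 0 < ln y by lra.
apply: (@le_trans _ _ ((ln (ln (maxmod F y)) / ln y)%:E)); last first.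
  by apply: ereal_sup_ubound; exists y => //; exact: MV.
rewrite lee_fin ler_pdivlMr //.
apply: le_trans (lnln_maxmod_ge y1 yb).
have h : `|ln (lam / 2)| <= e * ln y.
  rewrite (mulrC e) -ler_pdivrMr //; lra.
have := ler_norm (- ln (lam / 2)); rewrite normrN; lra.
Qed.

End GrowthOrder.

(** * Limits of the masses along an ultrafilter *)

Lemma sumr_const_seq (V : nmodType) (I : Type) (s : seq I) (x : V) :
  \sum_(i <- s) x = x *+ size s.
Proof. by rewrite big_const_seq count_predT iter_addr addr0. Qed.

Lemma prodr_const_seq (A : pzSemiRingType) (I : Type) (s : seq I) (x : A) :
  \prod_(i <- s) x = x ^+ size s.
Proof. by rewrite big_const_seq count_predT iter_mulr mulr1. Qed.

Section PaddedSequences.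
Variable R : realType.
Implicit Types s : seq R.

(** Padding with 0, where [g] is neutral, makes the split at [N] valid for lists shorter than [N]
    too. *)
Lemma big_padded (T : Type) (idx : T) (op : Monoid.law idx) (g : R -> T) s N :
  g 0 = idx ->
  \big[op/idx]_(m <- s) g m =
  op (\big[op/idx]_(j <- iota 0 N) g (nth 0 s j)) (\big[op/idx]_(m <- drop N s) g m).
Proof.
move=> g0; elim: N s => [|N IH] s; first by rewrite big_nil drop0 Monoid.mul1m.
case: s => [|m s].
  rewrite !big_nil Monoid.mulm1 big1_seq // => i _.
  by rewrite nth_nil.
rewrite big_cons (IH s) /= big_cons -Monoid.mulmA; congr (op _ (op _ _)).
by rewrite -[1%N]addn0 iotaDl big_map.
Qed.

Lemma nth_sorted_le s i j : sorted >=%R s -> {in s, forall m, 0 <= m} ->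
  (i <= j)%N -> nth 0 s j <= nth 0 s i.
Proof.
move=> ss s0 ij; have [js|js] := ltnP j (size s).
  have ge_trans : transitive (>=%R : rel R) by move=> y x z xy yz; exact: le_trans yz xy.
  have ge_refl : reflexive (>=%R : rel R) by move=> x; exact: lexx.
  by apply: (sorted_leq_nth ge_trans ge_refl 0 ss) => //; rewrite inE ?(leq_ltn_trans ij).
rewrite (nth_default _ js); have [si|si] := ltnP i (size s).
  by apply: s0; exact: mem_nth.
by rewrite nth_default.
Qed.

Lemma nth_nneg s i : {in s, forall m, 0 <= m} -> 0 <= nth 0 s i.
Proof.
move=> s0; have [si|si] := ltnP i (size s); last by rewrite nth_default.
by apply: s0; exact: mem_nth.
Qed.

Lemma mem_drop_le s N m : sorted >=%R s -> {in s, forall m, 0 <= m} ->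
  m \in drop N s -> 0 <= m <= nth 0 s N.
Proof.
move=> ss s0 mD; rewrite s0 ?(mem_drop mD) //=.
have [i _ <-] := nthP 0 mD.
by rewrite nth_drop nth_sorted_le // leq_addr.
Qed.

Lemma cabs_cprod_sub (t : R) s1 s2 : 0 <= t -> {in s2, forall m, 0 <= m /\ t * m <= 1 / 2} ->
  cabs (cprod s1 t%:C) * expR (- (2 * t * \sum_(m <- s2) m)) <= cabs (cprod (s1 ++ s2) t%:C).
Proof.
move=> t0 hs; rewrite cprod_cat cabsM ler_wpM2l ?cabs_ge0 //.
by rewrite [in leRHS]cprod_real cabs_real (le_trans (prod1B_expR t0 hs)) // ler_norm.
Qed.

End PaddedSequences.

Section FiniteCvg.
Variables (R : realType) (T : Type) (G : set_system T) (I : Type).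
Context {PG : ProperFilter G}.

Lemma cvg_sum_seq (f : T -> I -> R) (l : I -> R) (s : seq I) :
  (forall i, (fun k => f k i) @ G --> l i) ->
  (fun k => \sum_(i <- s) f k i) @ G --> \sum_(i <- s) l i.
Proof.
move=> fl; elim: s => [|i s IH].
  rewrite big_nil (_ : (fun k => _) = (fun=> 0)); first exact: cvg_cst.
  by apply/funext => k; rewrite big_nil.
rewrite big_cons (_ : (fun k => _) = (fun k => f k i + \sum_(j <- s) f k j)).
  exact: cvgD.
by apply/funext => k; rewrite big_cons.
Qed.

Lemma cvgC_prod_seq (f : T -> I -> Cplx R) (l : I -> Cplx R) (s : seq I) :
  (forall i, (fun k => f k i) @ G --> l i) ->
  (fun k => \prod_(i <- s) f k i) @ G --> \prod_(i <- s) l i.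
Proof.
move=> fl; elim: s => [|i s IH].
  rewrite big_nil (_ : (fun k => _) = (fun=> 1)); first exact: cvgC_cst.
  by apply/funext => k; rewrite big_nil.
rewrite big_cons (_ : (fun k => _) = (fun k => f k i * \prod_(j <- s) f k j)).
  exact (cvgCM (fl i) IH).
by apply/funext => k; rewrite big_cons.
Qed.

End FiniteCvg.

Section LimitMasses.
Variables (R : realType) (U : set_system nat).
Context {UU : UltraFilter U}.
Variable M : nat -> seq R.
Hypothesis M_sorted : forall k, sorted >=%R (M k).
Hypothesis M_ge0 : forall k, {in M k, forall m, 0 <= m}.
Variables (mu : nat -> R) (S : R).
Hypothesis mu_cvg : forall j, (fun k => nth 0 (M k) j) @ U --> mu j.
Hypothesis S_cvg : (fun k => \sum_(m <- M k) m) @ U --> S.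

Lemma mu_ge0 j : 0 <= mu j.
Proof.
apply: (cvgr_to_ge (@mu_cvg j)); apply: filterE => k.
exact: nth_nneg (@M_ge0 k).
Qed.

Lemma mu_noninc i j : (i <= j)%N -> mu j <= mu i.
Proof.
move=> ij; apply: (ler_cvg_to (@mu_cvg j) (@mu_cvg i)).
by apply: filterE => k; exact: nth_sorted_le (M_sorted k) (@M_ge0 k) ij.
Qed.

Lemma tail_cvg N :
  (fun k => \sum_(m <- drop N (M k)) m) @ U --> S - \sum_(j <- iota 0 N) mu j.
Proof.
have -> : (fun k => \sum_(m <- drop N (M k)) m) =
    (fun k => \sum_(m <- M k) m - \sum_(j <- iota 0 N) nth 0 (M k) j).
  apply/funext => k; apply/eqP; rewrite eq_sym subr_eq addrC eq_sym.
  by apply/eqP/esym; exact: (big_padded (g := id) +%R (M k) N).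
by apply: cvgB => //; exact: cvg_sum_seq.
Qed.

Lemma sum_mu_le N : \sum_(j <- iota 0 N) mu j <= S.
Proof.
rewrite -subr_ge0; apply: (cvgr_to_ge (tail_cvg (N := N))); apply: filterE => k.
by rewrite big_seq sumr_ge0 // => m /mem_drop /M_ge0.
Qed.

(** Otherwise, by monotonicity, every [mu j] is at least e, and more than S / e of them sum to more
    than S. *)
Lemma mu_small (e : R) : 0 < e -> exists N, forall j, (N <= j)%N -> mu j < e.
Proof.
move=> e0; apply: contrapT => h.
have mue j : e <= mu j.
  rewrite leNgt; apply/negP => mj; apply: h; exists j => i ji.
  exact: le_lt_trans (mu_noninc ji) mj.
have S0 : 0 <= S by have := sum_mu_le 0; rewrite big_nil.
pose N := (Num.truncn (S / e)).+1.
have : S < N%:R * e.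
  by rewrite -ltr_pdivrMr // /N truncnS_gt.
apply/negP; rewrite -leNgt; apply: le_trans (sum_mu_le N).
rewrite mulr_natl -[X in e *+ X](size_iota 0 N) -sumr_const_seq.
by apply: ler_sum => j _.
Qed.

(** By sortedness the entry at [N] dominates the whole tail, so one limit controls all of it at
    once. *)
Lemma tail_le_near N (t c : R) : 0 <= t -> t * mu N < c ->
  \forall k \near U, {in drop N (M k), forall m, 0 <= m /\ t * m <= c}.
Proof.
move=> t0 tc.
have : (fun k => t * nth 0 (M k) N) @ U --> t * mu N by apply: cvgM => //; exact: cvg_cst.
move/cvgr_lt => /(_ c tc); apply: filterS => k tk m.
move=> /(mem_drop_le (M_sorted k) (@M_ge0 k)) /andP[m0 mN]; split=> //.
by apply: le_trans (ltW tk); rewrite ler_wpM2l.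
Qed.

(** Each of the masses beyond the first [N] is at least d^2 / 4, so their number times d^2 is at
    most four times the tail; the first [N] cost only N d^2, which tends to 0. *)
Lemma size_bound_near (r : nat -> nat) (d : nat -> R) N (e : R) :
  d @ U --> (0 : R) -> 0 < e ->
  (\forall k \near U, size (M k) = r k /\ {in M k, forall m, d k ^+ 2 / 4 <= m}) ->
  \forall k \near U,
    (r k)%:R * d k ^+ 2 < 4 * (S - \sum_(j <- iota 0 N) mu j) + e.
Proof.
move=> d0 e0 Mr.
pose w k := N%:R * (d k * d k) + 4 * \sum_(m <- drop N (M k)) m.
have wc : w @ U --> N%:R * (0 * 0) + 4 * (S - \sum_(j <- iota 0 N) mu j).
  apply: cvgD; apply: cvgM; [exact: cvg_cst|exact: cvgM|exact: cvg_cst|exact: tail_cvg].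
have Se : 4 * (S - \sum_(j <- iota 0 N) mu j) < 4 * (S - \sum_(j <- iota 0 N) mu j) + e.
  by rewrite ltrDl.
move/cvgr_lt: wc; rewrite !mulr0 add0r => /(_ _ Se).
apply: filterS2 Mr => k [sM dM].
apply: le_lt_trans; rewrite /w.
have : \sum_(m <- drop N (M k)) (d k ^+ 2 / 4) <= \sum_(m <- drop N (M k)) m.
  by rewrite big_seq [leRHS]big_seq; apply: ler_sum => m /mem_drop /dM.
rewrite sumr_const_seq size_drop sM -mulr_natl => hs.
(* Only an inequality, since the subtraction is truncated when r k < N. *)
have hN : (r k)%:R <= N%:R + (r k - N)%:R :> R by rewrite -natrD ler_nat -leq_subLR.
have d2 : 0 <= d k ^+ 2 by exact: sqr_ge0.
have := ler_wpM2r d2 hN; rewrite mulrDl -expr2; lra.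
Qed.

End LimitMasses.

(** * The limit function: absence of lost mass, and orders of its zeros *)

Lemma derivable_affine_pow (R : realType) (b x c : Cplx R) n z :
  derivable (fun z : Cplx R => b * (- (z + x) * c) ^+ n : Cplx R) z 1.
Proof.
pose f : Cplx R -> Cplx R := cst b * ((- (id + cst x)) * cst c) ^+ n.
have -> : (fun z : Cplx R => b * (- (z + x) * c) ^+ n : Cplx R) = f.
  by apply/funext => w; rewrite /f fctE /= exprfctE.
apply: derivableM; first exact: derivable_cst.
apply: derivableX; apply: derivableM; last exact: derivable_cst.
apply: derivableN; apply: derivableD; [exact: derivable_id|exact: derivable_cst].
Qed.

Lemma derivable_comp_sq (R : realType) (A H : Cplx R -> Cplx R) z :
  derivable A z 1 -> (forall u, derivable H u 1) ->
  derivable (fun z : Cplx R => A z * H (z ^+ 2) : Cplx R) z 1.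
Proof.
move=> dA dH.
pose sq : Cplx R -> Cplx R := fun z => z ^+ 2.
have -> : (fun z : Cplx R => A z * H (z ^+ 2) : Cplx R) = A * (H \o sq) by [].
apply: derivableM; first exact: dA.
apply/derivable1_diffP.
refine (@differentiable_comp (Cplx R) (Cplx R) (Cplx R) (Cplx R) sq H z _ _).
  have -> : sq = id ^+ 2 by apply/funext => w; rewrite exprfctE.
  by apply/derivable1_diffP; apply: derivableX; exact: derivable_id.
by apply/derivable1_diffP; exact: dH.
Qed.

Lemma card_eq_size (s : seq nat) : uniq s -> ([set` s] #= `I_(size s))%card.
Proof.
move=> us; rewrite card_eq_sym; apply/card_set_bijP; exists (nth 0%N s); split.
- by move=> i /= si; exact: mem_nth.
- move=> i j; rewrite !inE /= => si sj e.
  by apply/eqP; rewrite -(nth_uniq 0%N si sj us) e.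
- by move=> j /= /(nthP 0%N)[i si <-]; exists i.
Qed.

Section LimitFunction.
Variables (R : realType) (U : set_system nat).
Context {UU : UltraFilter U}.
Variables (M : nat -> seq R) (K : R).
Hypothesis M_sorted : forall k, sorted >=%R (M k).
Hypothesis M_ge0 : forall k, {in M k, forall m, 0 <= m}.
Hypothesis M_le : forall k, \sum_(m <- M k) m <= K.
Variables (mu : nat -> R) (S : R).
Hypothesis mu_cvg : forall j, (fun k => nth 0 (M k) j) @ U --> mu j.
Hypothesis S_cvg : (fun k => \sum_(m <- M k) m) @ U --> S.
Variables (F : Cplx R -> Cplx R) (b : R).
Hypothesis b_gt0 : 0 < b.
Hypothesis F_lim : forall z (l : Cplx R),
  (fun k => cprod (M k) (z ^+ 2)) @ U --> l -> F z = b%:C * l.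

(** Otherwise every tail keeps mass at least e in the limit. Tail masses being small, their factors
    at z = iy multiply to at least about exp(e y^2 / 2), which forces order at least 2. *)
Lemma sum_mu_defect (e : R) : (growth_order F < 2%:E)%E -> 0 < e ->
  exists N, S - e < \sum_(j <- iota 0 N) mu j.
Proof.
move=> oF e0; apply: contrapT => h.
have he N : e <= S - \sum_(j <- iota 0 N) mu j.
  rewrite lerBrDl -lerBrDr leNgt; apply/negP => lt; apply: h; exists N; exact: lt.
have [g [gP _]] := cprod_ultra_cvg M_ge0 M_le.
move: oF; apply/negP; rewrite -leNgt.
apply: (@growth_order_ge2 _ F b (e / 2)) => //; last 1 first.
- move=> y y0; rewrite (F_lim (gP ((0 +i* y) ^+ 2))) cabsM cabs_real gtr0_norm //.
  rewrite ler_pM2l //.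
  have -> : (0 +i* y) ^+ 2 = (- (y ^+ 2))%:C :> Cplx R.
    by apply/eqP; rewrite expr2 eq_complex /=; apply/andP; split; apply/eqP; ring.
  set t := y ^+ 2; have t0 : 0 < t by exact: exprn_gt0.
  have ti0 : 0 < t^-1 by rewrite invr_gt0.
  (* [N] depends on y, but the mass e beyond it does not, so the final bound is uniform in y. *)
  have [N muN] := mu_small M_sorted M_ge0 mu_cvg S_cvg ti0.
  have tN : t * mu N < 1 by rewrite -ltr_pdivlMl // mulr1 muN.
  have near1 := @tail_le_near _ _ UU _ M_sorted M_ge0 _ mu_cvg _ _ _ (ltW t0) tN.
  have tc := @tail_cvg _ _ UU _ _ _ mu_cvg S_cvg N.
  have ec : (fun k => expR (t / 2 * \sum_(m <- drop N (M k)) m)) @ U -->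
      expR (t / 2 * (S - \sum_(j <- iota 0 N) mu j)).
    apply: (@continuous_cvg _ _ _ U _ _ expR); first exact: continuous_expR.
    by apply: cvgM => //; exact: cvg_cst.
  apply: (@le_trans _ _ (expR (t / 2 * (S - \sum_(j <- iota 0 N) mu j)))).
    rewrite ler_expR; have := he N; have : 0 < t / 2 by rewrite divr_gt0.
    by move=> ? ?; nra.
  apply: (ler_cvg_to ec (cvg_cabs (gP (- t)%:C))).
  apply: filterS near1 => k hk.
  rewrite cprod_real cabs_real; apply: (le_trans _ (ler_norm _)).
  have -> : \prod_(m <- M k) (1 - - t * m) = \prod_(m <- M k) (1 + t * m).
    by apply: eq_bigr => m _; rewrite mulNr opprK.
  apply: (le_trans (prod1D_expR (ltW t0) hk)).
  rewrite [leRHS](big_padded *%R (M k) N (g := fun m => 1 + t * m)) ?mulr0 ?addr0 //.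
  (* The first [N] factors 1 + t m are at least 1. *)
  rewrite ler_peMl //.
    by rewrite big_seq prodr_ge0 // => m /hk[m0 _]; rewrite addr_ge0 // mulr_ge0 // ltW.
  elim: (iota 0 N) => [|j s IH]; first by rewrite big_nil.
  rewrite big_cons -[X in X <= _](mulr1 1); apply: ler_pM => //.
  by rewrite lerDl mulr_ge0 ?(ltW t0) // nth_nneg.
- by move=> r; exists (b * expR (r ^+ 2 * K)) => z zr;
  rewrite (F_lim (gP (z ^+ 2))) cabsM cabs_real gtr0_norm // ler_pM2l //;
  apply: (cvgr_to_le (cvg_cabs (gP (z ^+ 2)))); apply: filterE => k;
  rewrite -zr -cabsX; exact: (cabs_cprod_bounded M_ge0 M_le).
- by rewrite divr_gt0.
Qed.

(* Discarding from the products the factors whose mass tends to 1 / x^2 leaves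
   products whose limit H does not vanish at x^2. *)
Lemma vanishing_order_limit (x : R) : 0 < x -> exists2 m : nat,
  ([set n | mu n = (x ^+ 2)^-1] #= `I_m)%card & vanishing_order F x%:C m.
Proof.
move=> x0; set t := x ^+ 2; have t0 : 0 < t by exact: exprn_gt0.
(* Below half of 1 / t, a mass cannot have the limit 1 / t, and its factor 1 - t m stays away from
   0. *)
have ti0 : 0 < t^-1 / 2 by rewrite divr_gt0 // invr_gt0.
have [N muN] := mu_small M_sorted M_ge0 mu_cvg S_cvg ti0.
pose J j := mu j == t^-1.
pose js := [seq j <- iota 0 N | J j].
have JE : [set n | mu n = t^-1] = [set` js].
  apply/seteqP; split=> n /=; rewrite mem_filter mem_iota /= add0n;
    last by case/andP => /eqP.
  move=> mun; rewrite /J mun eqxx /= ltnNge; apply/negP => /muN; rewrite mun.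
  by move=> h; have : 0 < t^-1 / 2 := ti0; lra.
exists (size js); first by rewrite JE; apply: card_eq_size; rewrite filter_uniq ?iota_uniq.
(* The masses that remain once the positions in [js] are removed. *)
pose E k := [seq nth 0 (M k) j | j <- iota 0 N & ~~ J j] ++ drop N (M k).
have ME k u : cprod (M k) u = \prod_(j <- js) (1 - u * (nth 0 (M k) j)%:C) * cprod (E k) u.
  rewrite cprod_cat mulrA.
  have -> : \prod_(j <- js) (1 - u * (nth 0 (M k) j)%:C)
      * cprod [seq nth 0 (M k) j | j <- iota 0 N & ~~ J j] u
      = \prod_(j <- iota 0 N) (1 - u * (nth 0 (M k) j)%:C).
    by rewrite /cprod big_map !big_filter [RHS](bigID J).
  by apply: (big_padded *%R (M k) N (g := fun m => 1 - u * m%:C)); rewrite mulr0 subr0.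
have E_ge0 k : {in E k, forall m, 0 <= m}.
  move=> m; rewrite mem_cat => /orP[/mapP[j _ ->]|/mem_drop/M_ge0 //].
  exact: nth_nneg (@M_ge0 k).
have E_le k : \sum_(m <- E k) m <= K.
  apply: le_trans (M_le k); rewrite big_cat big_map big_filter /=.
  rewrite [leRHS](big_padded +%R (M k) N (g := id)) // lerD2r.
  by rewrite [leRHS](bigID J) /= lerDr sumr_ge0 // => j _; exact: nth_nneg (@M_ge0 k).
have [g [gP _]] := cprod_ultra_cvg M_ge0 M_le.
have [H [HP dH]] := cprod_ultra_cvg E_ge0 E_le.
have gH u : g u = (1 - u * (t^-1)%:C) ^+ size js * H u.
  have pc : (fun k => \prod_(j <- js) (1 - u * (nth 0 (M k) j)%:C)) @ U -->
      \prod_(j <- js) (1 - u * (mu j)%:C).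
    apply: (@cvgC_prod_seq _ _ _ _ _ (fun k j => 1 - u * (nth 0 (M k) j)%:C)) => j.
    exact (cvgCB (cvgC_cst 1) (cvgCM (cvgC_cst u) (cvg_realC (@mu_cvg j)))).
  have gc : (fun k => cprod (M k) u) @ U --> \prod_(j <- js) (1 - u * (mu j)%:C) * H u.
    rewrite (_ : (fun k => _) = fun k => \prod_(j <- js) (1 - u * (nth 0 (M k) j)%:C)
      * cprod (E k) u); last by apply/funext => k; exact: ME.
    exact (cvgCM pc (HP u)).
  rewrite (cvgC_unique (gP u) gc) -prodr_const_seq; congr (_ * _).
  by rewrite big_seq [RHS]big_seq; apply: eq_bigr => j; rewrite mem_filter => /andP[/eqP->].
(* The finitely many head factors kept have nonzero limits at t, and the tail product is at least
   exp(-2 t K). *)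
have Ht : H t%:C != 0.
  pose A k := [seq nth 0 (M k) j | j <- iota 0 N & ~~ J j].
  have Ac : (fun k => cabs (cprod (A k) t%:C)) @ U -->
      cabs (\prod_(j <- iota 0 N | ~~ J j) (1 - t%:C * (mu j)%:C)).
    apply: cvg_cabs; rewrite /A /cprod.
    rewrite (_ : (fun k => _) = fun k => \prod_(j <- [seq j <- iota 0 N | ~~ J j])
      (1 - t%:C * (nth 0 (M k) j)%:C)); last by apply/funext => k; rewrite big_map.
    rewrite -big_filter.
    apply: (@cvgC_prod_seq _ _ _ _ _ (fun k j => 1 - t%:C * (nth 0 (M k) j)%:C)) => j.
    exact (cvgCB (cvgC_cst 1) (cvgCM (cvgC_cst _) (cvg_realC (@mu_cvg j)))).
  have tN : t * mu N < 1 / 2.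
    by rewrite -ltr_pdivlMl // div1r; exact: muN.
  have hA : cabs (\prod_(j <- iota 0 N | ~~ J j) (1 - t%:C * (mu j)%:C))
      * expR (- (2 * t * K)) <= cabs (H t%:C).
    apply: (@ler_cvg_to _ U _ _ (fun k => cabs (cprod (A k) t%:C) * expR (- (2 * t * K)))
      (fun k => cabs (cprod (E k) t%:C))).
    - by apply: cvgM => //; exact: cvg_cst.
    - exact: cvg_cabs.
    - have := @tail_le_near _ _ UU _ M_sorted M_ge0 _ mu_cvg _ _ _ (ltW t0) tN.
      apply: filterS => k hk.
      apply: le_trans (cabs_cprod_sub (A k) (ltW t0) hk).
      rewrite ler_wpM2l ?cabs_ge0 // ler_expR lerN2 ler_wpM2l ?mulr_ge0 ?(ltW x0) //.
      apply: le_trans (E_le k); rewrite /E big_cat /= lerDr.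
      by rewrite big_map sumr_ge0 // => j _; exact: nth_nneg (@M_ge0 k).
  rewrite -cabs_eq0 gt_eqF //; apply: lt_le_trans hA.
  rewrite mulr_gt0 ?expR_gt0 // lt_neqAle cabs_ge0 andbT eq_sym cabs_eq0.
  rewrite -big_filter prodf_seq_neq0; apply/allP => j; rewrite mem_filter => /andP[Jj _] /=.
  rewrite -rmorphM -(rmorph1 (real_complex R)) -rmorphB eq_complex /= eqxx andbT subr_eq0.
  by apply: contra Jj => /eqP e; rewrite /J -[X in X == _](mulKf (lt0r_neq0 t0)) -e mulr1.
(* With t = x^2, 1 - z^2 / t = (z - x) (-(z + x) / t); the second factor does not vanish at x and
   goes into the cofactor. *)
pose A : Cplx R -> Cplx R :=
  fun z => b%:C * (- (z + x%:C) * (t^-1)%:C) ^+ size js.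
exists (fun z => A z * H (z ^+ 2)); split.
- apply: (@filterE _ (nbhs (x%:C : Cplx R))) => z.
  apply: derivable_comp_sq; [exact: derivable_affine_pow|exact: dH].
- rewrite mulf_neq0 //; last by rewrite -rmorphXn.
  rewrite mulf_neq0 ?expf_neq0 //; first by rewrite eq_complex /= eqxx andbT gt_eqF.
  rewrite -rmorphD -rmorphN -rmorphM eq_complex /= eqxx andbT.
  by rewrite mulf_neq0 ?oppr_eq0 ?gt_eqF ?addr_gt0 ?invr_gt0.
- apply: (@filterE _ (nbhs (x%:C : Cplx R))) => z; rewrite (F_lim (gP _)) gH /A.
  have -> : 1 - z ^+ 2 * (t^-1)%:C = (z - x%:C) * (- (z + x%:C) * (t^-1)%:C).
    have -> : 1 = x%:C ^+ 2 * (t^-1)%:C :> Cplx R.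
      by rewrite -rmorphXn -rmorphM divff ?rmorph1 // gt_eqF.
    by ring.
  by rewrite exprMn; set p := (z - _) ^+ _; set q := (_ * _) ^+ _; ring.
Qed.

End LimitFunction.

(** * Listing the zeros by the limit masses, and sums over them *)

Section LimitListing.
Variables (R : realType) (U : set_system nat).
Context {UU : UltraFilter U}.
Variables (M : nat -> seq R) (K : R).
Hypothesis M_sorted : forall k, sorted >=%R (M k).
Hypothesis M_ge0 : forall k, {in M k, forall m, 0 <= m}.
Hypothesis M_le : forall k, \sum_(m <- M k) m <= K.
Variables (mu : nat -> R) (S : R).
Hypothesis mu_cvg : forall j, (fun k => nth 0 (M k) j) @ U --> mu j.
Hypothesis S_cvg : (fun k => \sum_(m <- M k) m) @ U --> S.
Variables (F : Cplx R -> Cplx R) (b : R).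
Hypothesis b_gt0 : 0 < b.
Hypothesis F_lim : forall z (l : Cplx R),
  (fun k => cprod (M k) (z ^+ 2)) @ U --> l -> F z = b%:C * l.
Hypothesis F_order : (growth_order F < 2%:E)%E.

(** Multiplicities come from [vanishing_order_limit]; since [mu] is nonincreasing, its positive
    values occupy an initial segment and their inverse square roots increase. *)
Lemma limit_listing :
  lists_positive_zeros F [set n | 0 < mu n] (fun n => (Num.sqrt (mu n))^-1).
Proof.
have mu0 := @mu_ge0 _ _ UU _ M_ge0 _ mu_cvg.
have muN := @mu_noninc _ _ UU _ M_sorted M_ge0 _ mu_cvg.
split=> [m n mn /= mun|n /= mun|m n /= mun mn|x x0].
- exact: lt_le_trans (muN _ _ mn).
- by rewrite invr_gt0 sqrtr_gt0.
- have mum : 0 < mu m := lt_le_trans mun (muN _ _ mn).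
  by rewrite lef_pV2 ?posrE ?sqrtr_gt0 // ler_sqrt // muN.
- have [m Jm Fm] := vanishing_order_limit M_sorted M_ge0 M_le mu_cvg S_cvg b_gt0 F_lim x0.
  exists m => //; rewrite (_ : [set n | _] = [set n | mu n = (x ^+ 2)^-1]) //.
  apply/seteqP; split=> n /=.
    by move=> [mun <-]; rewrite exprVn invrK sqr_sqrtr.
  move=> mun; rewrite mun invr_gt0 exprn_gt0 //; split=> //.
  by rewrite sqrtrV ?sqr_ge0 // invrK sqrtr_sqr gtr0_norm.
Qed.

Variables (I : set nat) (gamma : nat -> R).
Hypothesis F_zeros : lists_positive_zeros F I gamma.

Lemma listing_sum (P : R -> bool) :
  (\sum_(n <oo | (n \in I) && P (gamma n)) ((gamma n ^+ 2)^-1)%:E =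
   \sum_(n <oo | (0 < mu n)%R && P (Num.sqrt (mu n))^-1%R) (mu n)%:E)%E.
Proof.
rewrite (nneseries_listing P (phi := fun x => ((x ^+ 2)^-1)%:E) _ F_zeros limit_listing);
  last by move=> x; rewrite lee_fin invr_ge0 sqr_ge0.
have e n : (n \in [set n | 0 < mu n]) = (0 < mu n) by apply/idP/idP; rewrite inE.
under eq_eseriesl do rewrite e.
apply: eq_eseriesr => n /andP[mun _].
by rewrite exprVn invrK sqr_sqrtr // ltW.
Qed.

Lemma listing_sum_le : (\sum_(n <oo | n \in I) ((gamma n ^+ 2)^-1)%:E <= S%:E)%E.
Proof.
have -> : (\sum_(n <oo | n \in I) ((gamma n ^+ 2)^-1)%:E =
    \sum_(n <oo | (n \in I) && xpredT (gamma n)) ((gamma n ^+ 2)^-1)%:E)%E.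
  by apply: eq_eseriesl => n; rewrite andbT.
rewrite (listing_sum xpredT); apply: lime_le.
  by apply: is_cvg_nneseries_cond => n _ /andP[mun _]; rewrite lee_fin ltW.
apply: nearW => N; rewrite sumEFin lee_fin.
apply: le_trans (@sum_mu_le _ _ UU _ M_ge0 _ _ mu_cvg S_cvg N).
rewrite -[in leRHS](subn0 N) -/(index_iota 0 N) [leRHS](bigID (fun n => (0 < mu n) && true)) /=.
by rewrite lerDl sumr_ge0 // => n _; exact: (@mu_ge0 _ _ UU _ M_ge0 _ mu_cvg).
Qed.

(** Choose [N] with [mu j] < 1 / A^2 from [N] on: the zeros listed from there exceed A, and since no
    mass is lost they account for the whole tail up to any e. *)
Lemma tail_le_listing_sum A : 0 < A -> exists N, ((S - \sum_(j <- iota 0 N) mu j)%:E <=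
  \sum_(n <oo | (n \in I) && (A < gamma n)%R) ((gamma n ^+ 2)^-1)%:E)%E.
Proof.
move=> A0; rewrite (listing_sum (fun x => A < x)).
have mu0 := @mu_ge0 _ _ UU _ M_ge0 _ mu_cvg.
have Ai0 : 0 < (A ^+ 2)^-1 by rewrite invr_gt0 exprn_gt0.
have [N muN] := mu_small M_sorted M_ge0 mu_cvg S_cvg Ai0.
exists N; apply/lee_addgt0Pr => e e0.
have [N1 hN1] := sum_mu_defect M_sorted M_ge0 M_le mu_cvg S_cvg b_gt0 F_lim F_order e0.
pose P n := (0 < mu n) && (A < (Num.sqrt (mu n))^-1).
have P0 n : (0 <= n)%N -> P n -> (0 <= (mu n)%:E)%E by move=> _ _; rewrite lee_fin.
have := nneseries_lim_ge (N + N1) P0 => hlim.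
apply: (@le_trans _ _ ((\sum_(0 <= n < N + N1 | P n) (mu n)%:E) + e%:E)%E); last first.
  by rewrite leeD2r.
rewrite sumEFin -EFinD lee_fin.
have h1 : \sum_(j <- iota 0 N1) mu j <= \sum_(j <- iota 0 (N + N1)) mu j.
  by rewrite addnC iotaD big_cat /= lerDl sumr_ge0.
have h2 : \sum_(j <- iota 0 (N + N1)) mu j =
    \sum_(j <- iota 0 N) mu j + \sum_(j <- iota N N1) mu j by rewrite iotaD big_cat.
have h3 : \sum_(j <- iota N N1) mu j <= \sum_(0 <= n < N + N1 | P n) mu n.
  rewrite /index_iota subn0 iotaD big_cat /= add0n -[leLHS]add0r lerD ?sumr_ge0 //.
  (* From [N] on, [P] fails only where [mu] is 0. *)
  rewrite [leLHS](bigID P) /= gerDl le_eqVlt; apply/orP; left; apply/eqP.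
  rewrite big_seq_cond big1 // => n; rewrite mem_iota /P => /andP[/andP[Nn _]].
  have [mun|//] := ltrP 0 (mu n); last by move=> mun0 _; apply/eqP; rewrite eq_le mun0 mu0.
  rewrite /= => /negP[]; rewrite -(gtr0_norm A0) -sqrtr_sqr -sqrtrV ?sqr_ge0 //.
  rewrite ltr_sqrt ?invr_gt0 // -[A ^+ 2]invrK ltf_pV2 ?posrE //; exact: muN.
lra.
Qed.

End LimitListing.

(** * From ultrafilter limits to the limit superior *)

Lemma pointwise_of_family_compact (R : realType) (f : nat -> Cplx R -> Cplx R) F z :
  {family compact, f @ \oo --> F} -> (fun k => f k z) @ \oo --> F z.
Proof.
move=> /fam_cvgP /(_ _ (compact_set1 (x := z))).
by rewrite uniform_set1.
Qed.

Lemma limn_esup_le_near (R : realType) (u : nat -> R) (l : R) :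
  (forall e, 0 < e -> \forall k \near \oo, u k < l + e) ->
  (limn_esup (fun k => (u k)%:E) <= l%:E)%E.
Proof.
move=> ul; apply/lee_addgt0Pr => e e0.
pose V := [set k | u k < l + e].
apply: (@le_trans _ _ (ereal_sup [set (u k)%:E | k in V])).
  by apply: ereal_inf_lbound; exists V => //; exact: ul.
by apply: ge_ereal_sup => _ [k /= /ltW uk <-]; rewrite -EFinD lee_fin.
Qed.

Theorem theorem2p3 (R : realType)
  (d c : nat -> R) (r : nat -> nat) (Q : nat -> {poly R}) (a : nat -> nat -> R)
  (f : nat -> Cplx R -> Cplx R) (F : Cplx R -> Cplx R)
  (d_gt0 : forall k, (1 <= k)%N -> 0 < d k)
  (c_gt0 : forall k, (1 <= k)%N -> 0 < c k)
  (r_ge1 : forall k, (1 <= k)%N -> (1 <= r k)%N)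
  (Q_deg : forall k, (1 <= k)%N -> size (Q k) = (r k).+1)
  (Q_cheb : forall k, (1 <= k)%N ->
     Q k = (a k 0%N)%:P + 2 *: \sum_(1 <= m < (r k).+1) a k m *: chebT R m)
  (a_ge0 : forall k m, (1 <= k)%N -> (m <= r k)%N -> 0 <= a k m)
  (a_lead : forall k, (1 <= k)%N -> 0 < a k (r k))
  (Q_roots : forall k, (1 <= k)%N -> forall z : Cplx R,
     root (map_poly (real_complex R) (Q k)) z ->
     exists2 x : R, -1 <= x < 1 & z = x%:C)
  (f_def : forall k, (1 <= k)%N -> forall z : Cplx R,
     f k z = (c k)%:C * (map_poly (real_complex R) (Q k)).[ccos ((d k)%:C * z)])
  (f_cvg : {family compact, f @ \oo --> F})
  (F0_gt0 : 0 < F 0)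
  (d_cvg0 : d @ \oo --> (0 : R))
  (F_order : (growth_order F < 2%:E)%E) :
  [/\ exists I gamma, lists_positive_zeros F I gamma,
      forall I gamma, lists_positive_zeros F I gamma ->
        (\sum_(n <oo | n \in I) ((gamma n ^+ 2)^-1)%:E < +oo)%E /\
        forall A : R, 0 < A -> F (A%:C) * F ((- A)%:C) != 0 ->
          (limn_esup (fun k => ((r k)%:R * d k ^+ 2)%:E) <=
           4%:E * \sum_(n <oo | (n \in I) && (A < gamma n)%R)
                    ((gamma n ^+ 2)^-1)%:E)%E
    & (fun k => (r k)%:R * d k ^+ 2) @ \oo --> (0 : R)].
Proof.
have Fz z : (fun k => f k z) @ \oo --> F z := pointwise_of_family_compact (z := z) f_cvg.
pose b := complex.Re (F 0).
(* In the order on complex numbers, positivity includes being real. *)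
have F0b : F 0 = b%:C by apply/esym/RRe_real/gtr0_real.
have b0 : 0 < b by rewrite -ltcR -F0b.
have near1 : \forall k \near \oo, (1 <= k)%N by exists 1%N.
have dgt : \forall k \near \oo, 0 < d k by apply: filterS near1.
have /choice[s sP] : forall k, exists s : seq R, (1 <= k)%N ->
    [/\ size s = r k, sorted >=%R s, {in s, forall m, d k ^+ 2 / 4 <= m} &
    forall z, f k z = f k 0 * cprod s (cversin (d k) z)].
  move=> k; have [k1|k0] := boolP (1 <= k)%N; last by exists [::].
  have [s [ss so sd sQ]] := cos_poly_product (d_gt0 k k1) (Q_deg k k1) (Q_roots k k1).
  exists s => _; split=> // z.
  by rewrite !f_def // sQ mulr0 ccos0 mulrA.
have s_ge0 k : (1 <= k)%N -> {in s k, forall m, 0 <= m}.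
  move=> k1 m ms; have [_ _ sd _] := sP k k1.
  by apply: le_trans (sd m ms); rewrite divr_ge0 ?sqr_ge0.
(* Eventually |f_k(0)| > b / 2 and |f_k(i)| < |F(i)| + 1, while |f_k(i)| is at least |f_k(0)| times
   a quarter of the total mass; hence the factor 8. *)
pose K := 8 * (cabs (F (0 +i* 1)) + 1) / b.
have K0 : 0 <= K by rewrite divr_ge0 ?(ltW b0) // mulr_ge0 // addr_ge0 // cabs_ge0.
have cabs_f z : (fun k => cabs (f k z)) @ \oo --> cabs (F z).
  by apply: cvg_cabs; exact: Fz.
have s_le : \forall k \near \oo, \sum_(m <- s k) m <= K.
  have ci_lt : \forall k \near \oo, cabs (f k (0 +i* 1)) < cabs (F (0 +i* 1)) + 1.
    by have /cvgr_lt := @cabs_f (0 +i* 1); apply; rewrite ltrDl.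
  have c0_gt : \forall k \near \oo, b / 2 < cabs (f k 0).
    have /cvgr_gt := @cabs_f 0; apply.
    by rewrite F0b cabs_real gtr0_norm // ltr_pdivrMr // ltr_pMr // ltr1n.
  apply: filterS3 ci_lt c0_gt near1 => k hi h0 k1.
  have [_ _ _ fk] := sP k k1.
  have [t t4 ct] := cversin_imag_ge (d_gt0 k k1).
  have t0 : 0 <= t by apply: le_trans t4.
  have := prod1D_ge t0 (s_ge0 k k1).
  move: hi; rewrite fk ct cprod_real cabsM cabs_real.
  have -> : \prod_(m <- s k) (1 - - t * m) = \prod_(m <- s k) (1 + t * m).
    by apply: eq_bigr => m _; rewrite mulNr opprK.
  set p := \prod_(m <- s k) _; set q := \sum_(m <- s k) m => hi hp.
  have q0 : 0 <= q by rewrite /q big_seq sumr_ge0 // => m /(s_ge0 k k1).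
  have p1 : 1 / 4 * q <= p.
    apply: le_trans hp; apply: le_trans (_ : t * q <= _); first by rewrite ler_wpM2r.
    by rewrite lerDr.
  have np : p <= `|p| := ler_norm p.
  rewrite /K ler_pdivlMr //.
  have h1 : b / 2 * (1 / 4 * q) <= cabs (f k 0) * `|p|.
    apply: ler_pM => //; [by rewrite divr_ge0 // ltW|by rewrite mulr_ge0|exact: ltW|].
    exact: le_trans p1 np.
  lra.
(* The mass bound holds only eventually. Emptying the list at the other indices makes it hold for
   every [k] and changes no limit along an ultrafilter containing the cofinite sets. *)
pose good k := (1 <= k)%N && (\sum_(m <- s k) m <= K).
pose M k := if good k then s k else [::].
have goodN : \forall k \near \oo, good k.
  by apply: filterS2 near1 s_le => k k1 sk; rewrite /good k1 sk.
have M_sorted k : sorted >=%R (M k).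
  by rewrite /M; case: ifP => // /andP[/sP[]].
have M_ge0 k : {in M k, forall m, 0 <= m}.
  by rewrite /M; case: ifP => // /andP[/s_ge0 sk _] m; exact: sk.
have M_le k : \sum_(m <- M k) m <= K.
  by rewrite /M; case: ifP => [/andP[]//|_]; rewrite big_nil.
have limits (U : set_system nat) (UU : UltraFilter U) : \oo `<=` U ->
  exists (mu : nat -> R) (S : R),
  [/\ forall j, (fun k => nth 0 (M k) j) @ U --> mu j,
      (fun k => \sum_(m <- M k) m) @ U --> S &
      forall z (l : Cplx R), (fun k => cprod (M k) (z ^+ 2)) @ U --> l -> F z = b%:C * l].
  move=> oU.
  have M_sum0 k : 0 <= \sum_(m <- M k) m.
    by rewrite big_seq sumr_ge0 // => m /M_ge0.
  have /choice[mu muP] : forall j, exists x : R, (fun k => nth 0 (M k) j) @ U --> x.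
    move=> j; apply: (ultra_bounded_cvg (K := K)) => k.
    rewrite ger0_norm ?nth_nneg //; apply: le_trans (M_le k).
    have [jM|Mj] := ltnP j (size (M k)); last by rewrite nth_default.
    rewrite (big_nth 0) (bigD1_seq j) ?mem_index_iota ?iota_uniq //= lerDl.
    by rewrite sumr_ge0 // => i _; exact: nth_nneg.
  have [S SP] : exists x : R, (fun k => \sum_(m <- M k) m) @ U --> x.
    by apply: (ultra_bounded_cvg (K := K)) => k; rewrite ger0_norm.
  exists mu, S; split; [exact: muP|exact: SP|] => z l zl.
  have dU : d @ U --> (0 : R) := cvg_trans (cvg_app d oU) d_cvg0.
  have vU : (fun k => cversin (d k) z) @ U --> z ^+ 2 
    by exact (@cversin_cvg _ U _ d dU (oU _ dgt) z).
  have zU : (fun k => cprod (M k) (cversin (d k) z)) @ U --> l.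
    exact (cprod_cvg_moving M_ge0 M_le vU zl).
  have FU : (fun k => f k z) @ U --> F z := cvg_trans (cvg_app (f ^~ z) oU) (Fz z).
  have F0U : (fun k => f k 0) @ U --> (b%:C : Cplx R).
    by rewrite -F0b; exact: cvg_trans (cvg_app (f ^~ 0) oU) (Fz 0).
  (* F(z) and b l are both limits of f_k(z) along [U]. *)
  apply: (cvgC_unique FU).
  refine (cvg_cabs_dist (cvgCM F0U zU) (cvg_cst (0 : R)) _).
  apply: filterS (oU _ goodN) => k gk; rewrite le_eqVlt cabs_eq0 subr_eq0.
  have /andP[/sP[_ _ _ fk] _] := gk.
  by rewrite fk /M gk eqxx.
have M_size (U : set_system nat) (UU : UltraFilter U) : \oo `<=` U ->
    \forall k \near U, size (M k) = r k /\ {in M k, forall m, d k ^+ 2 / 4 <= m}.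
  move=> oU; apply: filterS (oU _ goodN) => k gk.
  by have /andP[/sP[ss _ sd _] _] := gk; rewrite /M gk.
have rd_le (U : set_system nat) (UU : UltraFilter U) : \oo `<=` U ->
    forall (mu : nat -> R) (S : R), (forall j, (fun k => nth 0 (M k) j) @ U --> mu j) ->
    (fun k => \sum_(m <- M k) m) @ U --> S -> forall N (e : R), 0 < e ->
    \forall k \near U, (r k)%:R * d k ^+ 2 < 4 * (S - \sum_(j <- iota 0 N) mu j) + e.
  move=> oU mu S muP SP N e e0.
  have dU : d @ U --> (0 : R) := cvg_trans (cvg_app d oU) d_cvg0.
  exact (size_bound_near muP SP N dU e0 (M_size U UU oU)).
(* One ultrafilter is enough for the listing and for summability, which concern [F] alone; the
   bounds on r_k d_k^2 are checked along all of them. *)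
have [W [WW oW]] := ultraFilterLemma (@eventually_filter).
have [mu [S [muP SP FP]]] := limits W WW oW.
split.
- exists [set n | 0 < mu n], (fun n => (Num.sqrt (mu n))^-1).
  exact (limit_listing M_sorted M_ge0 M_le muP SP b0 FP).
- move=> I gamma FI.
  have sum_lt : (\sum_(n <oo | n \in I) ((gamma n ^+ 2)^-1)%:E <= S%:E)%E.
    exact (listing_sum_le M_sorted M_ge0 M_le muP SP b0 FP FI).
  split=> [|A A0 _]; first exact: le_lt_trans sum_lt (ltry _).
  set B := (\sum_(n <oo | _) _)%E.
  have B0 : (0 <= B)%E.
    by apply: nneseries_ge0 => n _ _; rewrite lee_fin invr_ge0 sqr_ge0.
  (* Finiteness turns the bound into a real one, to be approached within e. *)
  have Bfin : B \is a fin_num.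
    rewrite ge0_fin_numE //; apply: le_lt_trans (le_lt_trans sum_lt (ltry _)).
    apply: subset_lee_nneseries => [n _|n /andP[]//].
    by rewrite lee_fin invr_ge0 sqr_ge0.
  rewrite -(fineK Bfin) -EFinM; apply: limn_esup_le_near => e e0.
  apply: ultra_near => U UU oU.
  have [nu [T [nuP TP HP]]] := limits U UU oU.
  have [N hN] := tail_le_listing_sum M_sorted M_ge0 M_le nuP TP b0 HP F_order FI A0.
  apply: filterS (rd_le U UU oU nu T nuP TP N e e0) => k hk.
  apply: (lt_le_trans hk); rewrite lerD2r ler_pM2l //.
  by rewrite -lee_fin fineK.
- apply/cvgrPdist_lt => e e0.
  apply: ultra_near => U UU oU.
  have [nu [T [nuP TP HP]]] := limits U UU oU.
  (* The budget is 4 (e / 8) for the tail plus e / 2 for the error of the size bound. *)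
  have e8 : 0 < e / 8 by rewrite divr_gt0.
  have [N hN] := sum_mu_defect M_sorted M_ge0 M_le nuP TP b0 HP F_order e8.
  have e2 : 0 < e / 2 by rewrite divr_gt0.
  apply: filterS (rd_le U UU oU nu T nuP TP N _ e2) => k hk.
  rewrite sub0r normrN ger0_norm; last exact: mulr_ge0 (ler0n _ _) (sqr_ge0 _).
  apply: (lt_trans hk); lra.
Qed.
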